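(* Let $\mathfrak{W}$ be the scalar rational Wiener algebra on $S^1_{\mathbb{Q}}$, let $\boldsymbol\Lambda_W$ be its group of units, and let $\boldsymbol\Lambda_W^{\pm}$ be the groups of units of the subalgebras $\mathfrak{W}^{\pm}$. Every $f\in\boldsymbol\Lambda_W$ admits a factorization $$f=f_-\,\chi_q\,f_+,\qquad f_-\in\boldsymbol\Lambda_W^-,\quad f_+\in\boldsymbol\Lambda_W^+,$$ where $q\in\mathbb{Q}$ is the winding number of $f$. The number $q$ is the same for every such factorization of $f$.
   Context: The universal solenoid is $S^1_{\mathbb{Q}}=\varprojlim S^1$ over positive integers ordered by divisibility, with bonding maps $z\mapsto z^{m/n}$ for $n\mid m$; it is a compact connected abelian group with Pontryagin dual the discrete group $\mathbb{Q}$. For $q=k/N\in\mathbb{Q}$ the corresponding character is $\chi_q(\mathbf{u})=\pi_N(\mathbf{u})^k$, where $\pi_N:S^1_{\mathbb{Q}}\to S^1$ is the projection to level $N$. The rational Wiener algebra $\mathfrak{W}=\mathfrak{W}_{\mathbb{Q}}$ is the Banach algebra of functions $f=\sum_{q\in\mathbb{Q}}a_q\chi_q:S^1_{\mathbb{Q}}\to\mathbb{C}$ with $\|f\|=\sum_{q\in\mathbb{Q}}|a_q|<\infty$ (pointwise multiplication). $\mathfrak{W}^+$ (resp. $\mathfrak{W}^-$) is the closed subalgebra of those $f$ with $a_q=0$ for $q<0$ (resp. $a_q=0$ for $q>0$). An element of $\mathfrak{W}$ is a unit of $\mathfrak W$ iff it vanishes nowhere on $S^1_{\mathbb{Q}}$.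 The winding number of a continuous $f:S^1_{\mathbb{Q}}\to\mathbb{C}^*$ is the unique $q\in\mathbb{Q}$ such that $f/|f|:S^1_{\mathbb{Q}}\to S^1$ is homotopic to the character $\chi_q$. *)

(* Defs.v *)
From HB Require Import structures.
From mathcomp Require Import all_boot all_order all_algebra finmap.
From mathcomp Require Import all_classical all_reals all_analysis.
From mathcomp Require Import complex.
From mathcomp Require summability.

Set Implicit Arguments.
Unset Strict Implicit.
Unset Printing Implicit Defensive.

Import Order.TTheory GRing.Theory Num.Theory.
Import numFieldNormedType.Exports.

Local Open Scope classical_set_scope.
Local Open Scope ring_scope.

(* [R[i]^o] is the field [R[i]] with the topology of its modulus; [R[i]] itself
   carries no topology in the libraries. *)
Notation Cplx R := (R[i]^o).

Section Solenoid.
Variable R : realType.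
Local Notation C := (Cplx R).

Definition circle : set C := [set z | `|z| = 1].

(* Levels are the positive integers: coordinate [n] is level [n.+1]. *)
Definition solenoid_set : set (prod_topology (fun _ : nat => C)) :=
  [set u | (forall n, circle (u n)) /\
    forall m n, (n.+1 %| m.+1)%N -> u n = u m ^+ (m.+1 %/ n.+1)].

Definition solenoid : topologicalType := set_type solenoid_set.

Definition proj_level (N : nat) (u : solenoid) : C := set_val u N.-1.

(* The fraction of [q] in lowest terms; [chiE] gives all other fractions. *)
Definition chi (q : rat) (u : solenoid) : C :=
  proj_level `|denq q|%N u ^ numq q.

Lemma chiE (u : solenoid) (k : int) (N : nat) : (0 < N)%N ->
  chi (k%:~R / N%:R) u = proj_level N u ^ k.
Proof.
move=> N0; have [_ h] := set_valP u.
set q := (X in chi X); rewrite /chi.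
have hq : (k * denq q = numq q * N%:Z).
  have e : (k%:~R * (denq q)%:~R = (numq q)%:~R * N%:R :> rat).
    rewrite numqE /q mulrAC divfK ?pnatr_eq0 -?lt0n//.
  by apply/eqP; rewrite -(eqr_int rat) !rmorphM /= e.
have [d ddef] : exists d, (N = d * `|denq q|)%N.
  have : (`|denq q| %| N)%N.
    rewrite -(Gauss_dvdr (n:=`|numq q|%N)) 1?coprime_sym ?coprime_num_den//.
    by rewrite -[N]absz_nat -abszM -hq abszM dvdn_mull.
  by move/dvdnP.
have den0 : (0 < `|denq q|)%N by rewrite absz_gt0 denq_neq0.
have d0 : (0 < d)%N by move: N0; rewrite ddef muln_gt0 => /andP[].
have -> : k = numq q * d%:Z.
  apply: (mulIf (denq_neq0 q)); rewrite hq ddef PoszM -mulrA; congr (_ * (_ * _)).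
  by rewrite gez0_abs.
have E : proj_level `|denq q| u = proj_level N u ^+ d.
  have := h N.-1 `|denq q|.-1; rewrite !prednK// => hh.
  by rewrite [LHS]hh ddef ?dvdn_mull// mulnK.
by rewrite E exprnP exprz_exp mulrC.
Qed.

(* [f = \sum_q a_q chi_q] with [\sum_q |a_q| < oo]; the sum at a point is the
   limit of the finite partial sums along the directed set [{fset rat}]. *)
Definition wiener_expansion (a : rat -> C) (f : solenoid -> C) : Prop :=
  (\esum_(q in [set: rat]) (complex.Re `|a q|)%:E < +oo)%E /\
  forall u, summability.partial_sum (fun q => a q * chi q u)
              @ summability.totally --> f u.

Definition wiener : set (solenoid -> C) :=
  [set f | exists a, wiener_expansion a f].

Definition wiener_plus : set (solenoid -> C) :=
  [set f | exists2 a, wiener_expansion a f & forall q, q < 0 -> a q = 0].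

Definition wiener_minus : set (solenoid -> C) :=
  [set f | exists2 a, wiener_expansion a f & forall q, 0 < q -> a q = 0].

Definition units_of (A : set (solenoid -> C)) : set (solenoid -> C) :=
  [set f | A f /\ exists2 g, A g & forall u, f u * g u = 1].

End Solenoid.

(* Homotopy of maps from [X] to the subspace [A] of [Y]; the values of [H]
   outside [X * [0, 1]] are irrelevant. *)
Definition homotopic_in (R : realType) (X Y : topologicalType) (A : set Y)
    (f g : X -> Y) : Prop :=
  exists H : X * R -> Y,
    [/\ {within [set: X] `*` [set` `[0%R, 1%R]], continuous H},
        forall x t, 0 <= t <= 1 -> A (H (x, t)),
        forall x, H (x, 0) = f x &
        forall x, H (x, 1) = g x].

Definition is_winding_number (R : realType) (f : solenoid R -> Cplx R)
    (q : rat) : Prop :=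
  unique (fun p => homotopic_in R (@circle R)
            (fun u => f u / `|f u| : Cplx R) (@chi R p)) q.

Definition is_factorization (R : realType) (f : solenoid R -> Cplx R)
    (fm : solenoid R -> Cplx R) (q : rat) (fp : solenoid R -> Cplx R) : Prop :=
  [/\ units_of (@wiener_minus R) fm, units_of (@wiener_plus R) fp &
      forall u, f u = fm u * chi q u * fp u].

(* Main.v *)
Require Import Defs.
From mathcomp Require Import all_boot all_order all_algebra.
From mathcomp Require Import all_classical all_reals all_analysis complex.
From mathcomp Require Import finmap ring lra.
From mathcomp Require summability.

Set Implicit Arguments.
Unset Strict Implicit.
Unset Printing Implicit Defensive.

Import Order.TTheory GRing.Theory Num.Theory.
Import numFieldNormedType.Exports.

Local Open Scope classical_set_scope.
Local Open Scope ring_scope.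

(** Why every unit factors, and why the exponent is the winding number.

    Let [f] be a unit with inverse [g] and let [p] be a finite character sum close
    to [f] in norm. Then [p = f (1 - w)] with [w = g (f - p)] small. All frequencies
    of [p] have a common denominator [N], so [p] is a polynomial in
    [z = chi N^-1] times a character. Since [z] maps the solenoid onto the circle
    and [p] vanishes nowhere, no root of the polynomial has modulus [1]; each
    linear factor [z - c] is then [z (1 - c / z)] or [- c (1 - z / c)], a character or
    constant times [1 - h] with [h] of norm less than [1] and one-sided spectrum
    ([factorizes_finite]).

    The factor [1 - w] is handled without logarithms. Solving
    [(1 - w) (1 + y) = 1 - z] with [y] supported in the nonnegative and [z] in the
    nonpositive frequencies ([Toeplitz_solution]) gives [f = p (1 + y) / (1 - z)], and
    for [w] of norm at most [1 / 3] both [y] and [z] have norm at most [1 / 2]. A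
    function [1 - h] with [h] of norm less than [1] is inverted by its Neumann
    series, within the subalgebra of [h] ([wiener_in_Neumann]). All convergence
    statements rest on one lemma, [wiener_in_sum], a form of Fubini.

    Every factor apart from the characters is a nonzero constant, a function
    [1 - h] with [|h| < 1], or the inverse of one, hence is null-homotopic in the
    punctured plane by straight segments. So [f / |f|] is homotopic to the character [chi q] of the
    factorization ([factorizes_unit], [null_homotopic_homotopic]).

    The winding number is unique because two characters homotopic to the same
    map differ by a bounded continuous phase: the solenoid is compact, so the
    homotopy can be cut into uniformly short steps, each with a continuous
    argument ([homotopic_phase]). Along the one-parameter subgroup [line], a
    nontrivial character turns without bound ([chi_bounded_phase]).

    The exponent of a factorization is unique for an algebraic reason
    ([factorization_exponent_le]): two different exponents would yield a nowhere
    vanishing function with only positive and also only nonpositive frequencies,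
    contradicting uniqueness of Fourier coefficients ([Fourier_unique]). *)

(** * Real-valued modulus of complex numbers *)

Section Modulus.
Variable R : realType.
Local Notation C := (Cplx R).
Implicit Types z w : C.

(** [`|z|] lives in [R[i]], whose order is partial; estimates are made in [R]. *)
Definition modulus z : R := complex.Re `|z|.

Lemma modulusE z : `|z| = (modulus z)%:C%C :> R[i].
Proof. by rewrite /modulus normc_def. Qed.

Lemma modulus_ReIm z :
  modulus z = Num.sqrt (complex.Re z ^+ 2 + complex.Im z ^+ 2).
Proof. by rewrite /modulus normc_def. Qed.

Lemma modulus_ge0 z : 0 <= modulus z.
Proof. by rewrite modulus_ReIm sqrtr_ge0. Qed.

Lemma modulus0 : modulus 0 = 0.
Proof. by rewrite /modulus normr0. Qed.

Lemma modulus1 : modulus 1 = 1.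
Proof. by rewrite /modulus normr1. Qed.

Lemma modulusM z w : modulus (z * w) = modulus z * modulus w.
Proof. by apply: (@complexI R); rewrite rmorphM -!modulusE normrM. Qed.

Lemma modulusN z : modulus (- z) = modulus z.
Proof. by rewrite /modulus normrN. Qed.

Lemma modulusV z : modulus z^-1 = (modulus z)^-1.
Proof. by apply: (@complexI R); rewrite fmorphV -!modulusE normfV. Qed.

Lemma modulusX z n : modulus (z ^+ n) = modulus z ^+ n.
Proof. by elim: n => [|n IH]; rewrite ?expr0 ?modulus1// !exprS modulusM IH. Qed.

Lemma modulus_eq0 z : (modulus z == 0) = (z == 0).
Proof. by rewrite -(inj_eq (@complexI R)) -modulusE normr_eq0. Qed.

Lemma modulusD z w : modulus (z + w) <= modulus z + modulus w.
Proof. by rewrite -lecR rmorphD/= -!modulusE ler_normD. Qed.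

Lemma modulusB z w : modulus (z - w) <= modulus z + modulus w.
Proof. by rewrite (le_trans (modulusD _ _))// modulusN. Qed.

Lemma modulusBC z w : modulus (z - w) = modulus (w - z).
Proof. by rewrite -modulusN opprB. Qed.

Lemma modulus_real (x : R) : modulus x%:C%C = `|x|.
Proof. by rewrite modulus_ReIm /= expr0n addr0 sqrtr_sqr. Qed.

Lemma modulus_sum (I : Type) (r : seq I) (P : pred I) (F : I -> C) :
  modulus (\sum_(i <- r | P i) F i) <= \sum_(i <- r | P i) modulus (F i).
Proof.
elim/big_rec2: _ => [|i x y _ h]; first by rewrite modulus0.
by rewrite (le_trans (modulusD _ _))// lerD2l.
Qed.

Lemma Re_le_modulus z : `|complex.Re z| <= modulus z.
Proof. by rewrite -lecR -modulusE normc_ge_Re. Qed.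

Lemma Im_le_modulus z : `|complex.Im z| <= modulus z.
Proof.
rewrite modulus_ReIm -[leLHS]sqrtr_sqr ler_sqrt ?lerDr ?sqr_ge0//.
by rewrite addr_ge0 ?sqr_ge0.
Qed.

Lemma circleP z : circle z <-> modulus z = 1.
Proof.
rewrite /circle /=; split=> [h|h]; first by rewrite /modulus h.
by rewrite modulusE h.
Qed.

End Modulus.

(** * Unordered sums and Fubini *)

Section UnorderedSums.
Variable R : realType.
Local Notation C := (Cplx R).

(** Finite subfamilies are duplicate-free lists; [bounded_sums] of a nonnegative
    family is its summability together with a bound for the sum. *)
Definition bounded_sums (I : choiceType) (b : I -> R) (M : R) :=
  forall s : seq I, uniq s -> \sum_(i <- s) b i <= M.

Definition has_sum (I : choiceType) (a : I -> C) (t : C) :=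
  forall e : R, 0 < e -> exists F : seq I, forall G : seq I, uniq G ->
    {subset F <= G} -> modulus (\sum_(i <- G) a i - t) < e.

Section OneIndex.
Variable I : choiceType.
Implicit Types (a : I -> C) (b : I -> R) (s F G : seq I).

Lemma perm_split s G : uniq s -> uniq G -> {subset s <= G} ->
  perm_eq G (s ++ [seq i <- G | i \notin s]).
Proof.
move=> us uG sG; apply: uniq_perm => //.
  rewrite cat_uniq us filter_uniq// andbT /=.
  by apply/hasPn => i; rewrite mem_filter => /andP[].
move=> i; rewrite mem_cat mem_filter.
by case: (boolP (i \in s)) => [/sG ->|].
Qed.

Lemma sum_split (V : nmodType) (a : I -> V) s G :
  uniq s -> uniq G -> {subset s <= G} ->
  \sum_(i <- G) a i
  = \sum_(i <- s) a i + \sum_(i <- [seq i <- G | i \notin s]) a i.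
Proof. by move=> us uG sG; rewrite (perm_big _ (perm_split us uG sG)) big_cat. Qed.

Lemma has_sum_finite a s : uniq s -> (forall i, i \notin s -> a i = 0) ->
  has_sum a (\sum_(i <- s) a i).
Proof.
move=> us a0 e e0; exists s => G uG sG; rewrite (sum_split a us uG sG).
rewrite [X in _ + X - _]big1_seq ?addr0 ?subrr ?modulus0// => i /=.
by rewrite mem_filter => /andP[/a0].
Qed.

Lemma has_sum_unique a t1 t2 : has_sum a t1 -> has_sum a t2 -> t1 = t2.
Proof.
move=> h1 h2; apply/eqP; rewrite -subr_eq0 -modulus_eq0.
rewrite eq_le modulus_ge0 andbT; apply/ler_addgt0Pr => e e0; rewrite add0r.
have e2 : 0 < e / 2 by rewrite divr_gt0.
have [F1 hF1] := h1 _ e2; have [F2 hF2] := h2 _ e2.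
set G := undup (F1 ++ F2); have uG : uniq G by exact: undup_uniq.
have s1 : {subset F1 <= G} by move=> i; rewrite mem_undup mem_cat => ->.
have s2 : {subset F2 <= G} by move=> i; rewrite mem_undup mem_cat orbC => ->.
have -> : t1 - t2 = (\sum_(i <- G) a i - t2) - (\sum_(i <- G) a i - t1) by ring.
rewrite (le_trans (modulusB _ _))// [leRHS]splitr ltW// ltrD//.
  exact: hF2.
exact: hF1.
Qed.

Lemma has_sumD a1 a2 t1 t2 : has_sum a1 t1 -> has_sum a2 t2 ->
  has_sum (fun i => a1 i + a2 i) (t1 + t2).
Proof.
move=> h1 h2 e e0; have e2 : 0 < e / 2 by rewrite divr_gt0.
have [F1 hF1] := h1 _ e2; have [F2 hF2] := h2 _ e2.
exists (F1 ++ F2) => G uG sG; rewrite big_split opprD addrACA.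
rewrite (le_lt_trans (modulusD _ _))// [ltRHS]splitr ltrD//.
  by apply: hF1 => // i h; apply: sG; rewrite mem_cat h.
by apply: hF2 => // i h; apply: sG; rewrite mem_cat h orbT.
Qed.

Lemma has_sumZ a t (c : C) : has_sum a t -> has_sum (fun i => c * a i) (c * t).
Proof.
move=> h e e0; have c0 : 0 < modulus c + 1 by rewrite ltr_wpDl// modulus_ge0.
have [F hF] := h _ (divr_gt0 e0 c0).
exists F => G uG sG; rewrite -mulr_sumr -mulrBr modulusM.
have := hF G uG sG; rewrite ltr_pdivlMr// => /le_lt_trans; apply.
by rewrite mulrC ler_wpM2l ?modulus_ge0// lerDl.
Qed.

Lemma has_sum_le a t M : bounded_sums (fun i => modulus (a i)) M -> has_sum a t ->
  modulus t <= M.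
Proof.
move=> aM h; apply/ler_addgt0Pr => e e0; have [F hF] := h e e0.
set G := undup F; have uG : uniq G by exact: undup_uniq.
have -> : t = \sum_(i <- G) a i - (\sum_(i <- G) a i - t) by ring.
rewrite (le_trans (modulusB _ _))// lerD//.
  by rewrite (le_trans (modulus_sum _ _ _))// aM.
by apply/ltW/hF => // i; rewrite mem_undup.
Qed.

Lemma bounded_sums_ge0 b M : bounded_sums b M -> 0 <= M.
Proof. by move=> /(_ [::] isT); rewrite big_nil. Qed.

Lemma bounded_sums_le b1 b2 M : (forall i, b1 i <= b2 i) ->
  bounded_sums b2 M -> bounded_sums b1 M.
Proof. by move=> b12 h s us; rewrite (le_trans _ (h s us))// ler_sum. Qed.

Lemma bounded_sumsD b1 b2 M1 M2 : bounded_sums b1 M1 -> bounded_sums b2 M2 ->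
  bounded_sums (fun i => b1 i + b2 i) (M1 + M2).
Proof. by move=> h1 h2 s us; rewrite big_split lerD//; [exact: h1|exact: h2]. Qed.

Lemma bounded_sumsZ b M c : 0 <= c -> bounded_sums b M ->
  bounded_sums (fun i => c * b i) (c * M).
Proof. by move=> c0 h s us; rewrite -mulr_sumr ler_wpM2l// h. Qed.

(** A finite subfamily within [e] of the supremum of the finite sums. *)
Lemma bounded_sums_tail b M : (forall i, 0 <= b i) -> bounded_sums b M ->
  forall e, 0 < e -> exists2 F, uniq F &
    bounded_sums (fun i => if i \in F then 0 else b i) e.
Proof.
move=> b0 bM e e0.
pose A := [set x | exists2 s, uniq s & x = \sum_(i <- s) b i].
have supA : has_sup A.
  split; first by exists 0; exists [::]; rewrite ?big_nil.
  by exists M => _ [s us ->]; exact: bM.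
have [_ [F uF ->] hF] := sup_adherent e0 supA.
exists F => // s us.
pose s' := [seq i <- s | i \notin F].
have -> : \sum_(i <- s) (if i \in F then 0 else b i) = \sum_(i <- s') b i.
  by rewrite big_filter [in RHS]big_mkcond; apply: eq_bigr => i _; case: (i \in F).
have uFs : uniq (F ++ s').
  rewrite cat_uniq uF filter_uniq// andbT /=.
  by apply/hasPn => i; rewrite mem_filter => /andP[].
have : \sum_(i <- F ++ s') b i <= sup A.
  by apply: ub_le_sup; [case: supA|exists (F ++ s')].
rewrite big_cat /=; move: hF; lra.
Qed.


Lemma bounded_sums_subset b s G : (forall i, 0 <= b i) -> uniq s -> uniq G ->
  {subset s <= G} -> \sum_(i <- s) b i <= \sum_(i <- G) b i.
Proof. by move=> b0 us uG sG; rewrite (sum_split b us uG sG) lerDl sumr_ge0. Qed.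

(** The sum is the supremum of the finite sums. *)
Lemma has_sum_nonneg b M : (forall i, 0 <= b i) -> bounded_sums b M ->
  exists t, has_sum (fun i => (b i)%:C%C : C) t.
Proof.
move=> b0 bM.
pose A := [set x | exists2 s, uniq s & x = \sum_(i <- s) b i].
have supA : has_sup A.
  split; first by exists 0; exists [::]; rewrite ?big_nil.
  by exists M => _ [s us ->]; exact: bM.
exists (sup A)%:C%C => e e0.
have [_ [F uF ->] hF] := sup_adherent e0 supA.
exists F => G uG sG; rewrite -raddf_sum -raddfB modulus_real /=.
have h1 : \sum_(i <- G) b i <= sup A.
  by apply: ub_le_sup; [case: supA|exists G].
have h2 := bounded_sums_subset b0 uF uG sG.
by rewrite ler0_norm; lra.
Qed.

(** Absolute convergence implies convergence, componentwise: each of the real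
    families [Re a] and [Im a] is the difference of the nonnegative families
    [|a| + Re a] and [|a|] (resp. [|a| + Im a] and [|a|]). *)
Lemma has_sum_exists a M : bounded_sums (fun i => modulus (a i)) M ->
  exists t, has_sum a t.
Proof.
move=> aM.
have part (x : I -> R) : (forall i, `|x i| <= modulus (a i)) ->
    exists t, has_sum (fun i => (modulus (a i) + x i)%:C%C : C) t.
  move=> xa; apply: (@has_sum_nonneg _ (M + M)) => [i|].
    by have := xa i; rewrite ler_norml => /andP[]; lra.
  apply: bounded_sums_le (bounded_sumsD aM aM) => i.
  by have := xa i; rewrite ler_norml => /andP[]; lra.
have [t1 h1] := part _ (fun i => Re_le_modulus (a i)).
have [t2 h2] := part _ (fun i => Im_le_modulus (a i)).
have [t3 h3] := has_sum_nonneg (fun i => modulus_ge0 (a i)) aM.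
exists (t1 + -1 * t3 + 'i%C * (t2 + -1 * t3)).
have := has_sumD (has_sumD h1 (has_sumZ (-1) h3))
  (has_sumZ 'i%C (has_sumD h2 (has_sumZ (-1) h3))).
congr has_sum; apply/funext => i.
rewrite [RHS]complexE !mulN1r -!raddfB /=.
by congr (_%:C + _ * _%:C)%C; ring.
Qed.

Lemma has_sum0 : has_sum (fun _ : I => 0 : C) 0.
Proof. by have := @has_sum_finite (fun=> 0) [::] isT (fun _ _ => erefl);
  rewrite big_nil. Qed.

End OneIndex.

Lemma has_sum_reindex (I J : choiceType) (g : I -> J) (h : J -> I) (a : J -> C) t :
  cancel g h -> cancel h g -> has_sum a t -> has_sum (fun i => a (g i)) t.
Proof.
move=> gK hK hs e e0; have [F hF] := hs e e0.
exists (map h F) => G uG sG; rewrite -(big_map g xpredT a); apply: hF.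
  by rewrite map_inj_uniq//; exact: can_inj gK.
move=> j jF; rewrite -[j]hK; apply: map_f; apply: sG.
exact: map_f.
Qed.

Lemma bounded_sums_reindex (I J : choiceType) (g : I -> J) (b : J -> R) M :
  injective g -> bounded_sums b M -> bounded_sums (fun i => b (g i)) M.
Proof. by move=> gI h s us; rewrite -(big_map g xpredT b) h// map_inj_uniq. Qed.

Section TwoIndices.
Variables I J : choiceType.

Lemma bounded_sums_prod (b : I * J -> R) (m : I -> R) M :
  (forall p, 0 <= b p) ->
  (forall i, bounded_sums (fun j => b (i, j)) (m i)) -> bounded_sums m M ->
  bounded_sums b M.
Proof.
move=> b0 hm hM s us.
pose I0 := undup (map fst s); pose J0 := undup (map snd s).
have uIJ : uniq [seq (i, j) | i <- I0, j <- J0].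
  by rewrite allpairs_uniq ?undup_uniq// => -[? ?] [? ?].
rewrite (le_trans (bounded_sums_subset b0 us uIJ _))//.
  move=> [i j] ij; apply: allpairs_f; rewrite mem_undup.
    exact: (map_f fst ij).
  exact: (map_f snd ij).
rewrite big_allpairs (le_trans _ (hM I0 (undup_uniq _)))// ler_sum// => i _.
by apply: hm; exact: undup_uniq.
Qed.

(** Each row sum is approximated by a finite sum with error [e / (#rows + 1)]. *)
Lemma bounded_sums_rows (a : I * J -> C) (r : I -> C) M :
  bounded_sums (fun p => modulus (a p)) M ->
  (forall i, has_sum (fun j => a (i, j)) (r i)) ->
  bounded_sums (fun i => modulus (r i)) M.
Proof.
move=> aM ar s us; apply/ler_addgt0Pr => e e0.
have e1 : 0 < e / (size s).+1%:R by rewrite divr_gt0.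
have /choice[F hF] : forall i, exists G, uniq G /\
    modulus (\sum_(j <- G) a (i, j) - r i) < e / (size s).+1%:R.
  move=> i; have [F hF] := ar i _ e1; exists (undup F); split; first exact: undup_uniq.
  by apply: hF => [|j]; rewrite ?undup_uniq// mem_undup.
have : \sum_(i <- s) modulus (r i) <=
    \sum_(i <- s) (\sum_(j <- F i) modulus (a (i, j)) + e / (size s).+1%:R).
  apply: ler_sum => i _; have [_ /ltW h] := hF i.
  have -> : r i = \sum_(j <- F i) a (i, j) - (\sum_(j <- F i) a (i, j) - r i) by ring.
  by rewrite (le_trans (modulusB _ _))// lerD// modulus_sum.
move=> /le_trans; apply; rewrite big_split /= lerD//.
  rewrite -(big_allpairs_dep (h := pair) (F := fun p => modulus (a p))).
  apply: aM; apply: allpairs_uniq_dep => //.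
    by move=> i _; case: (hF i).
  by move=> [i j] [i' j'] _ _ [-> ->].
rewrite big_const_seq count_predT iter_addr_0 -[leLHS]mulr_natr.
rewrite -mulrA ger_pMr// mulrC ler_pdivrMr// mul1r ler_nat.
exact: leqnSn.
Qed.

(** Fubini: outside a large enough finite box the family contributes at most
    [e] to both iterated sum and total sum; on the box both are finite sums. *)
Lemma has_sum_Fubini (a : I * J -> C) (r : I -> C) M t :
  bounded_sums (fun p => modulus (a p)) M ->
  (forall i, has_sum (fun j => a (i, j)) (r i)) ->
  has_sum a t -> has_sum r t.
Proof.
move=> aM ar at_; have [t' rt'] := has_sum_exists (bounded_sums_rows aM ar).
suff -> : t = t' by [].
apply/eqP; rewrite -subr_eq0 -modulus_eq0.
rewrite eq_le modulus_ge0 andbT; apply/ler_addgt0Pr => e e0; rewrite add0r.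
have e2 : 0 < e / 2 by rewrite divr_gt0.
have [F uF hF] := bounded_sums_tail (fun p => modulus_ge0 (a p)) aM e2.
(* the smallest box [B] containing [F] *)
pose I0 := undup (map fst F); pose J0 := undup (map snd F).
pose B := [seq (i, j) | i <- I0, j <- J0].
have uB : uniq B by rewrite allpairs_uniq ?undup_uniq// => -[? ?] [? ?].
have memB i j : ((i, j) \in B) = (i \in I0) && (j \in J0).
  apply/allpairsP/andP => [[[i' j'] [/= ? ? [-> ->]]]//|[iI jJ]].
  by exists (i, j).
have FB : {subset F <= B}.
  move=> [i j] ij; rewrite memB !mem_undup.
  by rewrite (map_f fst ij) (map_f snd ij).
pose inB p := if p \in B then a p else 0.
pose outB p := if p \in B then 0 else a p.
have outBe : bounded_sums (fun p => modulus (outB p)) (e / 2).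
  apply: bounded_sums_le hF => p; rewrite /outB.
  case: (boolP (p \in F)) => [/FB ->|_]; first by rewrite modulus0.
  by case: ifP; rewrite ?modulus0 ?modulus_ge0.
have sB : \sum_(p <- B) inB p = \sum_(i <- I0) \sum_(j <- J0) inB (i, j).
  by rewrite big_allpairs.
have inB_sum : has_sum inB (\sum_(p <- B) inB p).
  by apply: has_sum_finite => // p /negbTE; rewrite /inB => ->.
have inB_row i : has_sum (fun j => inB (i, j)) (\sum_(j <- J0) inB (i, j)).
  apply: has_sum_finite; first exact: undup_uniq.
  by move=> j /negbTE jJ; rewrite /inB memB jJ andbF.
have inB_rows : has_sum (fun i => \sum_(j <- J0) inB (i, j)) (\sum_(p <- B) inB p).
  rewrite sB; apply: has_sum_finite; first exact: undup_uniq.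
  by move=> i /negbTE iI; rewrite big1// => j _; rewrite /inB memB iI.
have out_sum : has_sum outB (t + -1 * \sum_(p <- B) inB p).
  have := has_sumD at_ (has_sumZ (-1) inB_sum); congr has_sum.
  by apply/funext => p; rewrite /inB /outB; case: ifP => _; ring.
have out_row i : has_sum (fun j => outB (i, j)) (r i + -1 * \sum_(j <- J0) inB (i, j)).
  have := has_sumD (ar i) (has_sumZ (-1) (inB_row i)); congr has_sum.
  by apply/funext => p; rewrite /inB /outB; case: ifP => _; ring.
have out_rows := has_sumD rt' (has_sumZ (-1) inB_rows).
have h1 := has_sum_le outBe out_sum.
have h2 := has_sum_le (bounded_sums_rows outBe out_row) out_rows.
set sg := \sum_(p <- B) inB p in h1 h2.
have -> : t - t' = (t + -1 * sg) - (t' + -1 * sg) by ring.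
by rewrite (le_trans (modulusB _ _))// [leRHS]splitr lerD.
Qed.

End TwoIndices.
End UnorderedSums.
(** * Characters of the solenoid *)

Section Characters.
Variable R : realType.
Local Notation C := (Cplx R).
Local Notation S := (solenoid R).
Implicit Types (u : S) (p q : rat).

Lemma common_denominator p q : exists k l N,
  [/\ (0 < N)%N, p = k%:~R / N%:R & q = l%:~R / N%:R].
Proof.
have nz (x : rat) : (`|denq x|%N%:R : rat) != 0.
  by rewrite pnatr_eq0 absz_eq0 denq_neq0.
have E (x : rat) : x = (numq x)%:~R / `|denq x|%N%:R.
  by rewrite pmulrn gez0_abs// divq_num_den.
exists (numq p * `|denq q|%N), (numq q * `|denq p|%N), (`|denq p| * `|denq q|)%N.
split.
- by rewrite muln_gt0 !absz_gt0 !denq_neq0.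
- by rewrite natrM intrM -pmulrn -mulf_div divff// mulr1 -E.
- by rewrite natrM intrM -pmulrn [X in _ / X]mulrC -mulf_div divff// mulr1 -E.
Qed.

Lemma modulus_proj_level N u : modulus (proj_level N u) = 1.
Proof. by have [h _] := set_valP u; apply/circleP; exact: h. Qed.

Lemma proj_level_neq0 N u : proj_level N u != 0.
Proof. by rewrite -modulus_eq0 modulus_proj_level oner_eq0. Qed.

Lemma modulus_chi q u : modulus (chi q u) = 1.
Proof.
rewrite /chi; case: (numq q) => n; rewrite ?NegzE.
  by rewrite modulusX modulus_proj_level expr1n.
by rewrite modulusV modulusX modulus_proj_level expr1n invr1.
Qed.

Lemma chi_neq0 q u : chi q u != 0.
Proof. by rewrite -modulus_eq0 modulus_chi oner_eq0. Qed.

Lemma chiD p q u : chi (p + q) u = chi p u * chi q u.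
Proof.
have [k [l [N [N0 -> ->]]]] := common_denominator p q.
by rewrite -mulrDl -rmorphD /= !chiE// expfzDr// proj_level_neq0.
Qed.

Lemma chi0 u : chi 0 u = 1.
Proof. by have := @chiE R u 0 1 isT; rewrite mul0r expr0z. Qed.

Lemma chiN q u : chi (- q) u = (chi q u)^-1.
Proof.
apply: (mulIf (chi_neq0 q u)); rewrite -chiD addNr chi0 mulVf//.
exact: chi_neq0.
Qed.

End Characters.

(** * Absolutely convergent character series *)

Section CharacterSeries.
Variable R : realType.
Local Notation C := (Cplx R).

Lemma gt0_realC (e : C) : 0 < e -> exists2 r : R, 0 < r & e = r%:C%C.
Proof.
case: e => x y; rewrite ltcE /= => /andP[/eqP y0 x0].
by exists x => //; rewrite y0.
Qed.

(** Links duplicate-free lists with the directed set of finite sets. *)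
Lemma has_sumP (I : choiceType) (a : I -> C) (t : C) :
  has_sum a t <-> summability.partial_sum a @ summability.totally --> t.
Proof.
have proper : ProperFilter (@summability.totally I).
  exact: summability.totally_filter.
split=> [h|h].
  apply/cvgrPdist_lt => _ /gt0_realC[e e0 ->].
  have [F hF] := h e e0.
  exists [fset i in F]%fset => //= G sG.
  rewrite modulusE ltcR modulusBC /summability.partial_sum.
  rewrite -(big_seq_fsetE _ G xpredT a) /=; apply: hF => //.
  by move=> i iF; apply: (fsubsetP sG); rewrite inE.
move=> e e0; have e0' : 0 < e%:C%C :> C by rewrite ltcR.
move/cvgrPdist_lt: h => /(_ _ e0')[F _ hF].
exists (enum_fset F) => G uG sG.
have := hF [fset i in G]%fset; rewrite /= modulusE ltcR modulusBC.
rewrite /summability.partial_sum -(big_seq_fsetE _ _ xpredT a) /=.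
have -> : \sum_(i <- [fset i in G]%fset) a i = \sum_(i <- G) a i.
  apply: perm_big; apply: uniq_perm => //.
  by move=> i; rewrite inE.
by apply; apply/fsubsetP => i /sG; rewrite inE.
Qed.

Lemma esum_bounded_sums (b : rat -> R) : (forall q, 0 <= b q) ->
  (\esum_(q in [set: rat]) (b q)%:E < +oo)%E <-> exists M, bounded_sums b M.
Proof.
move=> b0; split=> [h|[M hM]].
  exists (fine (\esum_(q in [set: rat]) (b q)%:E)%E) => s us.
  rewrite -lee_fin fineK; last first.
    by rewrite ge0_fin_numE// esum_ge0// => q _; rewrite lee_fin.
  apply: esum_ge; exists [set` s]; first by split=> //; exact: finite_seq.
  by rewrite -fsbig_seq// sumEFin.
apply: (@le_lt_trans _ _ M%:E); last by rewrite ltry.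
apply: ge_ereal_sup => _ [X [finX _] <-].
by rewrite fsbig_finite// sumEFin lee_fin hM.
Qed.

Lemma wiener_expansionP (a : rat -> C) (f : solenoid R -> C) :
  wiener_expansion a f <->
  (exists M, bounded_sums (fun q => modulus (a q)) M) /\
  forall u, has_sum (fun q => a q * chi q u) (f u).
Proof.
rewrite /wiener_expansion -(esum_bounded_sums (fun q => modulus_ge0 (a q))).
by split=> -[h1 h2]; split=> // u; apply/has_sumP.
Qed.

End CharacterSeries.

Section WienerIn.
Variable R : realType.
Local Notation C := (Cplx R).
Local Notation S := (solenoid R).
Implicit Types (u : S) (p q : rat) (A B : set rat) (f g : S -> C).

(** The functions of Wiener norm at most [M] with frequencies in [A]; keeping the
    bound and the spectrum in one predicate replaces the Banach algebra. *)
Definition wiener_in A (M : R) f := exists a : rat -> C,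
  [/\ bounded_sums (fun q => modulus (a q)) M,
      forall u, has_sum (fun q => a q * chi q u) (f u) &
      forall q, a q != 0 -> A q].

Lemma wiener_inW A B M N f : A `<=` B -> M <= N ->
  wiener_in A M f -> wiener_in B N f.
Proof.
move=> AB MN [a [h1 h2 h3]]; exists a; split=> // [s us|q /h3 /AB//].
exact: le_trans (h1 s us) MN.
Qed.

Lemma eq_wiener_in A M f g : f =1 g -> wiener_in A M f -> wiener_in A M g.
Proof. by move=> /funext ->. Qed.

Lemma wiener_in_ge0 A M f : wiener_in A M f -> 0 <= M.
Proof. by move=> [a [/bounded_sums_ge0]]. Qed.

Lemma wiener_in_le A M f u : wiener_in A M f -> modulus (f u) <= M.
Proof.
move=> [a [h1 h2 _]]; apply: has_sum_le (h2 u).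
by apply: bounded_sums_le h1 => q; rewrite modulusM modulus_chi mulr1.
Qed.

(** Completeness in the form used below: both iterated sums of
    [a_i q * chi q u] agree by Fubini, so a norm-summable family of functions
    sums pointwise to the function whose coefficients are the sums of theirs.
    Products, geometric series and the solution of the one-sided equation are
    all instances. *)
Lemma wiener_in_sum (I : choiceType) (F : I -> S -> C) (m : I -> R) A M :
  (forall i, wiener_in A (m i) (F i)) -> bounded_sums m M ->
  exists2 g, wiener_in A M g & forall u, has_sum (fun i => F i u) (g u).
Proof.
move=> /choice[a ha] hM.
have aM : bounded_sums (fun z : I * rat => modulus (a z.1 z.2)) M.
  apply: bounded_sums_prod hM => [z|i]; first exact: modulus_ge0.
  by have [] := ha i.
have swapK (X Y : choiceType) :
    cancel (fun z : X * Y => (z.2, z.1)) (fun z => (z.2, z.1)).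
  by case.
have aM' : bounded_sums (fun z : rat * I => modulus (a z.2 z.1)) M.
  apply: (bounded_sums_reindex (g := fun z : rat * I => (z.2, z.1))
    (b := fun z => modulus (a z.1 z.2))) aM.
  exact: can_inj (@swapK _ _).
have /choice[c hc] : forall q, exists t, has_sum (a ^~ q) t.
  move=> q; apply: (@has_sum_exists _ _ _ M).
  apply: (bounded_sums_reindex (g := fun i : I => (i, q))
    (b := fun z => modulus (a z.1 z.2))) aM.
  by move=> ? ? [].
have aMu u : bounded_sums (fun z : I * rat => modulus (a z.1 z.2 * chi z.2 u)) M.
  by apply: bounded_sums_le aM => z; rewrite modulusM modulus_chi mulr1.
have aMu' u : bounded_sums (fun z : rat * I => modulus (a z.2 z.1 * chi z.1 u)) M.
  by apply: bounded_sums_le aM' => z; rewrite modulusM modulus_chi mulr1.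
have /choice[g hg] : forall u, exists t,
    has_sum (fun z : I * rat => a z.1 z.2 * chi z.2 u) t.
  by move=> u; exact: has_sum_exists (aMu u).
exists g => [|u].
  exists c; split=> [|u|q].
  - exact: (@bounded_sums_rows _ _ _ (fun z : rat * I => a z.2 z.1)) hc.
  - apply: (@has_sum_Fubini _ _ _ _ _ _ _ (aMu' u)) => [q|].
      have := has_sumZ (chi q u) (hc q); rewrite mulrC; congr has_sum.
      by apply/funext => i; rewrite mulrC.
    exact: (has_sum_reindex (@swapK _ _) (@swapK _ _) (hg u)).
  - apply: contraPP => nAq; apply/negP; rewrite negbK; apply/eqP.
    apply: has_sum_unique (hc q) _.
    have -> : a ^~ q = fun=> 0; last exact: has_sum0.
    apply/funext => i; apply/eqP; apply/negPn/negP => h; apply: nAq.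
    by have [_ _] := ha i; exact.
by apply: (has_sum_Fubini (aMu u)) (hg u) => i; have [_ + _] := ha i; exact.
Qed.

Lemma wiener_in_finite A F (a : rat -> C) : uniq F -> {in F, forall q, A q} ->
  wiener_in A (\sum_(q <- F) modulus (a q)) (fun u => \sum_(q <- F) a q * chi q u).
Proof.
move=> uF FA; exists (fun q => if q \in F then a q else 0); split=> [s us|u|q].
- have -> : \sum_(q <- F) modulus (a q)
      = \sum_(q <- F) modulus (if q \in F then a q else 0).
    by apply: eq_big_seq => q ->.
  set b := fun q => modulus (if q \in F then a q else 0).
  rewrite (le_trans (bounded_sums_subset (G := undup (s ++ F)) _ us _ _))//.
  + by move=> q; exact: modulus_ge0.
  + by rewrite undup_uniq.
  + by move=> q; rewrite mem_undup mem_cat => ->.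
  have FsF : {subset F <= undup (s ++ F)}.
    by move=> q; rewrite mem_undup mem_cat orbC => ->.
  rewrite (sum_split b uF (undup_uniq _) FsF).
  rewrite [X in _ + X]big1_seq ?addr0// => q /=.
  by rewrite mem_filter => /andP[/negbTE qF _]; rewrite /b qF modulus0.
- have -> : \sum_(q <- F) a q * chi q u
      = \sum_(q <- F) (if q \in F then a q else 0) * chi q u.
    by apply: eq_big_seq => q ->.
  by apply: has_sum_finite => // q /negbTE ->; rewrite mul0r.
- by case: ifP => [/FA//|]; rewrite eqxx.
Qed.

Lemma wiener_in_chi A q (c : C) : A q ->
  wiener_in A (modulus c) (fun u => c * chi q u).
Proof.
move=> Aq; have := @wiener_in_finite A [:: q] (fun=> c) isT.
rewrite big_seq1; move=> h; apply: eq_wiener_in (h _) => [u|p].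
  by rewrite big_seq1.
by rewrite inE => /eqP ->.
Qed.

Lemma wiener_in_cst A (c : C) : A 0 -> wiener_in A (modulus c) (fun=> c).
Proof.
by move=> A0; apply: eq_wiener_in (wiener_in_chi c A0) => u; rewrite chi0 mulr1.
Qed.

Lemma wiener_inD A M N f g : wiener_in A M f -> wiener_in A N g ->
  wiener_in A (M + N) (fun u => f u + g u).
Proof.
move=> [a [a1 a2 a3]] [b [b1 b2 b3]]; exists (fun q => a q + b q); split.
- by apply: bounded_sums_le (bounded_sumsD a1 b1) => q; exact: modulusD.
- move=> u; have := has_sumD (a2 u) (b2 u); congr has_sum.
  by apply/funext => q; rewrite mulrDl.
- move=> q; have [a0|/a3//] := eqVneq (a q) 0.
  by rewrite a0 add0r; exact: b3.
Qed.

Lemma wiener_in_shift A B M f q (c : C) : (forall p, A p -> B (q + p)) ->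
  wiener_in A M f -> wiener_in B (modulus c * M) (fun u => c * chi q u * f u).
Proof.
move=> AB [a [a1 a2 a3]].
have sK : cancel (fun p : rat => - q + p) (+%R q) by move=> p; rewrite addNKr.
have sK' : cancel (+%R q) (fun p : rat => - q + p) by move=> p; rewrite addKr.
exists (fun p => c * a (- q + p)); split.
- apply: bounded_sums_le (bounded_sumsZ (modulus_ge0 c)
    (bounded_sums_reindex (can_inj sK) a1)) => p.
  by rewrite modulusM.
- move=> u; have := has_sumZ (c * chi q u) (has_sum_reindex sK sK' (a2 u)).
  congr has_sum; apply/funext => p.
  have -> : chi p u = chi q u * chi (- q + p) u by rewrite -chiD addNKr.
  by ring.
- move=> p; rewrite mulf_eq0 negb_or => /andP[_ /a3/AB].
  by rewrite sK.
Qed.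

Lemma wiener_inN A rho (h : S -> C) : wiener_in A rho h ->
  wiener_in A rho (fun u => - h u).
Proof.
move=> hA; have AA p : A p -> A (0 + p) by rewrite add0r.
have := wiener_in_shift (-1) AA hA.
rewrite modulusN modulus1 mul1r; apply: eq_wiener_in => u.
by rewrite chi0 mulr1 mulN1r.
Qed.

Lemma wiener_in_1B A rho (h : S -> C) : A 0 -> wiener_in A rho h ->
  wiener_in A (1 + rho) (fun u => 1 - h u).
Proof.
by move=> A0 hA; rewrite -(modulus1 R); exact: wiener_inD (wiener_in_cst 1 A0) (wiener_inN hA).
Qed.

(** The product is the unordered sum of the translates [a q chi_q g]. *)
Lemma wiener_inM A B D M N f g : (forall p q, A p -> B q -> D (p + q)) ->
  wiener_in A M f -> wiener_in B N g ->
  wiener_in D (M * N) (fun u => f u * g u).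
Proof.
move=> ABD [a [a1 a2 a3]] gB.
have N0 := wiener_in_ge0 gB.
have h p : wiener_in D (modulus (a p) * N) (fun u => a p * chi p u * g u).
  have [a0|/a3 Ap] := eqVneq (a p) 0.
    rewrite a0 modulus0 mul0r; exists (fun=> 0); split=> [s us|u|q].
    - by rewrite big1// modulus0.
    - rewrite !mul0r; have := @has_sum0 R rat.
      by congr has_sum; apply/funext => q; rewrite mul0r.
    - by rewrite eqxx.
  by apply: wiener_in_shift gB => q; exact: ABD.
have bM : bounded_sums (fun p => modulus (a p) * N) (M * N).
  rewrite mulrC; apply: bounded_sums_le (bounded_sumsZ N0 a1) => p.
  by rewrite mulrC.
have [k kD hk] := wiener_in_sum h bM.
apply: eq_wiener_in kD => u; apply: has_sum_unique (hk u) _.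
have := has_sumZ (g u) (a2 u); rewrite mulrC; congr has_sum.
by apply/funext => p; rewrite mulrC.
Qed.

(** Coefficients are distributed between [A] and [B], which costs no norm. *)
Lemma wiener_in_split A B M f : wiener_in (A `|` B) M f ->
  exists f1 f2 : S -> C, [/\ wiener_in A M f1, wiener_in B M f2 &
    forall u, f u = f1 u + f2 u].
Proof.
move=> [a [a1 a2 a3]].
pose aA q := if q \in A then a q else 0; pose aB q := if q \in A then 0 else a q.
have aAM : bounded_sums (fun q => modulus (aA q)) M.
  by apply: bounded_sums_le a1 => q; rewrite /aA; case: ifP; rewrite ?modulus0 ?modulus_ge0.
have aBM : bounded_sums (fun q => modulus (aB q)) M.
  by apply: bounded_sums_le a1 => q; rewrite /aB; case: ifP; rewrite ?modulus0 ?modulus_ge0.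
have ex (b : rat -> C) : bounded_sums (fun q => modulus (b q)) M ->
    exists g : S -> C, forall u, has_sum (fun q => b q * chi q u) (g u).
  move=> bM.
  suff /choice[g hg] : forall u, exists t, has_sum (fun q => b q * chi q u) t.
    by exists g.
  move=> u; apply: (@has_sum_exists _ _ _ M); apply: bounded_sums_le bM => q.
  by rewrite modulusM modulus_chi mulr1.
have [f1 h1] := ex _ aAM; have [f2 h2] := ex _ aBM.
exists f1, f2; split.
- exists aA; split=> // q; rewrite /aA; case: ifP => [|_]; last by rewrite eqxx.
  by move=> /set_mem.
- exists aB; split=> // q; rewrite /aB; case: ifP => [_|/negbT]; first by rewrite eqxx.
  by rewrite notin_setE => nA /a3 [].
- move=> u; apply: has_sum_unique (a2 u) _.
  have := has_sumD (h1 u) (h2 u); congr has_sum; apply/funext => q.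
  by rewrite /aA /aB; case: ifP => _; ring.
Qed.

Lemma wiener_in_approx A M f e : 0 < e -> wiener_in A M f ->
  exists F (a : rat -> C),
    wiener_in A e (fun u => f u - \sum_(q <- F) a q * chi q u).
Proof.
move=> e0 [a [a1 a2 a3]].
have [F uF hF] := bounded_sums_tail (fun q => modulus_ge0 (a q)) a1 e0.
exists F, a, (fun q => if q \in F then 0 else a q); split.
- by apply: bounded_sums_le hF => q; case: ifP; rewrite ?modulus0.
- move=> u; have h : has_sum (fun q => (if q \in F then a q else 0) * chi q u)
      (\sum_(q <- F) a q * chi q u).
    have -> : \sum_(q <- F) a q * chi q u
        = \sum_(q <- F) (if q \in F then a q else 0) * chi q u.
      by apply: eq_big_seq => q ->.
    by apply: has_sum_finite => // q /negbTE ->; rewrite mul0r.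
  have := has_sumD (a2 u) (has_sumZ (-1) h); rewrite mulN1r; congr has_sum.
  by apply/funext => q; case: ifP => _; ring.
- by move=> q; case: ifP => [|_ /a3//]; rewrite eqxx.
Qed.

End WienerIn.
(** * A one-parameter subgroup and uniqueness of Fourier coefficients *)

Section Line.
Variable R : realType.
Local Notation C := (Cplx R).
Local Notation S := (solenoid R).

Definition cis (t : R) : C := (cos t +i* sin t)%C.

Lemma cis0 : cis 0 = 1.
Proof. by rewrite /cis cos0 sin0. Qed.

Lemma cisD s t : cis (s + t) = cis s * cis t.
Proof.
rewrite /cis cosD sinD; apply/eqP; rewrite eq_complex /=.
by rewrite eqxx /=; apply/eqP; ring.
Qed.

Lemma modulus_cis t : modulus (cis t) = 1.
Proof. by rewrite modulus_ReIm /= cos2Dsin2 sqrtr1. Qed.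

Lemma cis_neq0 t : cis t != 0.
Proof. by rewrite -modulus_eq0 modulus_cis oner_eq0. Qed.

Lemma cisN t : cis (- t) = (cis t)^-1.
Proof. by apply: (mulIf (cis_neq0 t)); rewrite -cisD addNr cis0 mulVf ?cis_neq0. Qed.

Lemma cispi : cis pi = -1.
Proof. by rewrite /cis cospi sinpi; apply/eqP; rewrite eq_complex /= oppr0 !eqxx. Qed.

Lemma cisX t n : cis t ^+ n = cis (n%:R * t).
Proof.
elim: n => [|n IH]; first by rewrite expr0 mul0r cis0.
by rewrite exprS IH -cisD -[in RHS]natr1 mulrDl mul1r addrC.
Qed.

Lemma cisXz t (k : int) : cis t ^ k = cis (k%:~R * t).
Proof.
case: k => n; first by rewrite -exprnP cisX.
by rewrite NegzE -exprnN cisX rmorphN /= mulNr cisN.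
Qed.

(** The bounded range of angles is what makes the circle compact. *)
Lemma cis_surj (z : C) : modulus z = 1 -> exists2 t, -pi <= t <= pi & z = cis t.
Proof.
rewrite modulus_ReIm => h.
have := sqr_sqrtr (addr_ge0 (sqr_ge0 (complex.Re z)) (sqr_ge0 (complex.Im z))).
rewrite h expr1n => /esym {}h; move: h.
case: z => x y /= h.
have x1 : -1 <= x <= 1.
  rewrite -ler_norml -[leRHS]normr1 -ler_sqr ?nnegrE// !real_normK ?num_real//.
  by rewrite expr1n -h lerDl sqr_ge0.
have sx : sin (acos x) = `|y|.
  by rewrite sin_acos// -h addrAC subrr add0r sqrtr_sqr.
have := acos_ge0 x1; have := acos_lepi x1; have := pi_ge0 R => pi0 ax xa.
have cx : cos (acos x) = x by rewrite acosK// in_itv.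
have [y0|y0] := leP 0 y.
  by exists (acos x); [lra|rewrite /cis cx sx ger0_norm].
by exists (- acos x); [lra|rewrite /cis cosN sinN cx sx ltr0_norm// opprK].
Qed.

Lemma line_in (t : R) :
  solenoid_set (fun n : nat => cis (t / n.+1%:R) : C).
Proof.
split=> [n|m n]; first by apply/circleP; exact: modulus_cis.
move=> /dvdnP[k E]; rewrite cisX E mulnK//; congr cis.
have k0 : k%:R != 0 :> R by rewrite pnatr_eq0; case: k E.
by rewrite natrM invfM [in RHS]mulrCA mulVKf.
Qed.

(** The one-parameter subgroup dual to the inclusion of [rat] in [R]. *)
Definition line (t : R) : S :=
  exist (fun u => u \in @solenoid_set R) _ (mem_set (line_in t)).

Lemma proj_level_line N t : (0 < N)%N -> proj_level N (line t) = cis (t / N%:R).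
Proof. by case: N. Qed.

Lemma chi_line q t : chi q (line t) = cis (ratr q * t).
Proof.
have [k [l [N [N0 -> _]]]] := common_denominator q q.
rewrite chiE// proj_level_line// cisXz fmorph_div /= ratr_int ratr_nat.
by congr cis; rewrite mulrA mulrAC.
Qed.

(** Each projection of the solenoid onto a level is onto the circle; hence a
    polynomial in [chi N^-1] vanishing nowhere has no root of modulus [1]. *)
Lemma chi_surj (N : nat) (z : C) : (0 < N)%N -> modulus z = 1 ->
  exists u : S, chi N%:R^-1 u = z.
Proof.
move=> N0 /cis_surj[t _ ->]; exists (line (N%:R * t)).
by rewrite chi_line fmorphV /= ratr_nat mulrA mulVf ?mul1r// pnatr_eq0 -lt0n.
Qed.

(** Replacing [a q] by [a q (1 + chi_q v) / 2] kills the coefficient at any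
    [q] with [chi_q v = -1] without touching the one at [0]. *)
Lemma kill_frequencies (a : rat -> C) (F : seq rat) : 0 \notin F ->
  (forall t, has_sum (fun q => a q * cis (ratr q * t)) 0) ->
  exists b : rat -> C, [/\ b 0 = a 0, forall q, modulus (b q) <= modulus (a q),
    {in F, forall q, b q = 0} &
    forall t, has_sum (fun q => b q * cis (ratr q * t)) 0].
Proof.
move=> + h; elim: F => [|p F IH]; first by exists a.
rewrite inE negb_or eq_sym => /andP[p0 /IH[b [b0 ba bF hb]]].
(* [chi p] takes the value [-1] at [line v] *)
pose v : R := pi / ratr p.
have pv : ratr p * v = pi by rewrite mulrC divfK// fmorph_eq0.
exists (fun q => b q * ((1 + cis (ratr q * v)) / 2)); split.
- by rewrite raddf0 mul0r cis0 divff ?mulr1 ?b0// pnatr_eq0.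
- move=> q; apply: le_trans (ba q); rewrite modulusM ler_piMr ?modulus_ge0//.
  have -> : (1 + cis (ratr q * v)) / 2
      = (1 + cis (ratr q * v)) * (2 : R)^-1%:C%C.
    by rewrite fmorphV rmorph_nat.
  rewrite modulusM modulus_real ger0_norm ?invr_ge0//.
  rewrite ler_pdivrMr// mul1r (le_trans (modulusD _ _))//.
  by rewrite modulus1 modulus_cis.
- move=> q; rewrite inE => /orP[/eqP ->|/bF ->]; last by rewrite mul0r.
  by rewrite pv cispi subrr mul0r mulr0.
- move=> t; have := has_sumZ (2^-1) (has_sumD (hb t) (hb (t + v))).
  rewrite addr0 mulr0; congr has_sum; apply/funext => q.
  by rewrite [ratr q * (t + v)]mulrDr cisD; ring.
Qed.

(** Once the frequencies in a large finite set are killed, the constant term is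
    minus the sum of the remaining small tail. This replaces integration against
    Haar measure. *)
Lemma constant_coefficient_eq0 (a : rat -> C) M :
  bounded_sums (fun q => modulus (a q)) M ->
  (forall t, has_sum (fun q => a q * cis (ratr q * t)) 0) -> a 0 = 0.
Proof.
move=> aM h; apply/eqP; rewrite -modulus_eq0 eq_le modulus_ge0 andbT.
apply/ler_addgt0Pr => e e0; rewrite add0r.
have [F uF hF] := bounded_sums_tail (fun q => modulus_ge0 (a q)) aM e0.
have F0 : 0 \notin [seq q <- F | q != 0] by rewrite mem_filter eqxx.
have [b [b0 ba bF hb]] := kill_frequencies F0 h.
have hb0 : has_sum b 0.
  have := hb 0; congr has_sum; apply/funext => q.
  by rewrite mulr0 cis0 mulr1.
have hd : has_sum (fun q : rat => if q == 0 then a 0 else 0) (a 0).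
  have := @has_sum_finite R rat (fun q => if q == 0 then a 0 else 0) [:: 0] isT.
  by rewrite big_seq1 eqxx; apply => q; rewrite inE => /negbTE ->.
have := has_sumD hb0 (has_sumZ (-1) hd).
rewrite add0r mulN1r -modulusN; apply: has_sum_le.
apply: bounded_sums_le hF => q.
have [->|q0] := eqVneq q 0.
  by rewrite b0 mulN1r subrr modulus0; case: ifP; rewrite ?modulus_ge0.
rewrite mulr0 addr0; case: ifP => [qF|_]; last exact: ba.
by rewrite bF ?modulus0// mem_filter q0.
Qed.

(** Multiplying by [chi q] to the power [-1] turns any coefficient into the
    constant one. *)
Lemma Fourier_unique (a : rat -> C) M :
  bounded_sums (fun q => modulus (a q)) M ->
  (forall u : S, has_sum (fun q => a q * chi q u) 0) -> forall q, a q = 0.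
Proof.
move=> aM h q; rewrite -[q]addr0.
apply: (@constant_coefficient_eq0 (fun p => a (q + p)) M).
  by apply: (bounded_sums_reindex (g := +%R q)) aM; exact: addrI.
move=> t; have := has_sumZ (chi q (line t))^-1
  (has_sum_reindex (addKr q) (addNKr q) (h (line t))).
rewrite mulr0; congr has_sum; apply/funext => p.
by rewrite chiD -chi_line mulrC -mulrA; congr (_ * _); rewrite mulrC mulKf// chi_neq0.
Qed.

Lemma wiener_in_disjoint (A B : set rat) M N (f : S -> C) :
  (forall q, A q -> ~ B q) -> wiener_in A M f -> wiener_in B N f ->
  forall u, f u = 0.
Proof.
move=> AB [a [a1 a2 a3]] [b [b1 b2 b3]] u.
have ab q : a q - b q = 0.
  apply: (@Fourier_unique (fun q => a q - b q) (M + N)) => [|v].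
    by apply: bounded_sums_le (bounded_sumsD a1 b1) => p; exact: modulusB.
  have := has_sumD (a2 v) (has_sumZ (-1) (b2 v)).
  rewrite mulN1r subrr; congr has_sum; apply/funext => p.
  by ring.
apply: has_sum_unique (a2 u) _; have := @has_sum0 R rat; congr has_sum.
apply/funext => q; suff -> : a q = 0 by rewrite mul0r.
apply: contrapT => /eqP aq; apply: (AB q); first exact: a3.
by apply: b3; have /eqP := ab q; rewrite subr_eq0 => /eqP <-.
Qed.

End Line.
(** * Continuity of complex-valued maps *)

Section ComplexTopology.
Variable R : realType.
Local Notation C := (Cplx R).

Lemma cvg_modulusP (T : Type) (F : set_system T) (FF : Filter F) (f : T -> C) l :
  f @ F --> l <-> forall e : R, 0 < e -> \forall x \near F, modulus (f x - l) < e.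
Proof.
split=> [/cvgrPdist_lt h e e0|h].
  have e0' : 0 < e%:C%C :> C by rewrite ltcR.
  have := h _ e0'; apply: filterS => x /=.
  by rewrite modulusE ltcR modulusBC.
apply/cvgrPdist_lt => _ /gt0_realC[e e0 ->]; have := h _ e0.
by apply: filterS => x /= hx; rewrite modulusE ltcR modulusBC.
Qed.

Lemma ler_dist_modulus (z w : C) : `|modulus z - modulus w| <= modulus (z - w).
Proof.
have h1 := modulusD (z - w) w; have h2 := modulusD (w - z) z.
rewrite !subrK in h1 h2; rewrite modulusBC in h2.
by rewrite ler_norml; apply/andP; split; lra.
Qed.

Lemma modulus_lt_thirds (e : R) (x x' y y' : C) :
  modulus (x - y) <= e / 3 -> modulus (x' - y') <= e / 3 ->
  modulus (y - y') < e / 3 -> modulus (x - x') < e.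
Proof.
move=> hx hx' hy; have -> : x - x' = (x - y) - (x' - y') + (y - y') by ring.
have := modulusD (x - y - (x' - y')) (y - y').
have := modulusB (x - y) (x' - y').
move: (modulus _) (modulus _) (modulus _) (modulus _) (modulus _) hx hx' hy => a b c d f.
lra.
Qed.

Section AtFilter.
Variables (T : Type) (F : set_system T).
Context {FF : Filter F}.
Implicit Types (f : T -> C) (g : T -> R) (l : C) (r : R).

Lemma cvg_realC g r : g @ F --> r -> (fun x => (g x)%:C%C : C) @ F --> (r%:C%C : C).
Proof.
move=> /cvgrPdist_lt h; apply/cvg_modulusP => e e0; have := h _ e0.
by apply: filterS => x /=; rewrite -raddfB modulus_real distrC.
Qed.

Lemma cvg_modulus f l : f @ F --> l -> (fun x => modulus (f x)) @ F --> modulus l.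
Proof.
move=> /cvg_modulusP h; apply/cvgrPdist_lt => e e0; have := h _ e0.
apply: filterS => x /=; apply: le_lt_trans; rewrite distrC.
exact: ler_dist_modulus.
Qed.

Lemma cvg_Im f l : f @ F --> l -> (fun x => complex.Im (f x)) @ F --> complex.Im l.
Proof.
move=> /cvg_modulusP h; apply/cvgrPdist_lt => e e0; have := h _ e0.
apply: filterS => x /=; apply: le_lt_trans; rewrite distrC.
by rewrite -raddfB Im_le_modulus.
Qed.

End AtFilter.

Lemma continuous_cis : continuous (@cis R).
Proof.
move=> t; have -> : @cis R = fun t => (cos t)%:C%C + 'i%C * (sin t)%:C%C.
  by apply/funext => x; exact: complexE.
apply: cvgD; first by apply: cvg_realC; exact: continuous_cos.
apply: cvgM; first exact: cvg_cst.
by apply: cvg_realC; exact: continuous_sin.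
Qed.

Lemma continuous_expr (T : topologicalType) (f : T -> C) n :
  continuous f -> continuous (fun x => f x ^+ n).
Proof.
move=> cf x; elim: n => [|n IH].
  have -> : (fun y => f y ^+ 0) = (fun=> 1) by apply/funext => y; rewrite expr0.
  exact: cvg_cst.
have -> : (fun y => f y ^+ n.+1) = (fun y => f y * f y ^+ n).
  by apply/funext => y; rewrite exprS.
exact: cvgM (cf x) IH.
Qed.

Lemma continuous_constant (T : topologicalType) (c : C) :
  continuous (fun _ : T => c).
Proof. by move=> x; exact: cvg_cst. Qed.

Lemma continuous_inv (T : topologicalType) (f : T -> C) :
  (forall x, f x != 0) -> continuous f -> continuous (fun x => (f x)^-1).
Proof. by move=> f0 cf x; apply: cvgV => //; exact: cf. Qed.

Lemma continuous_mul (T : topologicalType) (f g : T -> C) :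
  continuous f -> continuous g -> continuous (fun x => f x * g x).
Proof. by move=> cf cg x; exact: cvgM (cf x) (cg x). Qed.

Lemma continuous_sub (T : topologicalType) (f g : T -> C) :
  continuous f -> continuous g -> continuous (fun x => f x - g x).
Proof. by move=> cf cg x; exact: cvgB (cf x) (cg x). Qed.

Lemma continuous_sum (T : topologicalType) (I : Type) (s : seq I) (f : I -> T -> C) :
  (forall i, continuous (f i)) -> continuous (fun x => \sum_(i <- s) f i x).
Proof.
move=> cf; elim: s => [|i s IH] x.
  have -> : (fun x => \sum_(i <- [::]) f i x) = (fun=> 0).
    by apply/funext => y; rewrite big_nil.
  exact: cvg_cst.
have -> : (fun x => \sum_(i <- i :: s) f i x) = (fun x => f i x + \sum_(i <- s) f i x).
  by apply/funext => y; rewrite big_cons.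
exact: cvgD (cf i x) (IH x).
Qed.

Lemma continuous_modulusP (T : topologicalType) (f : T -> C) :
  continuous f <-> forall x e, 0 < e ->
    \forall y \near x, modulus (f y - f x) < e.
Proof.
split=> [cf x e e0|h x]; first by move/cvg_modulusP: (cf x); exact.
by apply/cvg_modulusP => e e0; exact: h.
Qed.

End ComplexTopology.

(** * Topology of the solenoid *)

Section SolenoidTopology.
Variable R : realType.
Local Notation C := (Cplx R).
Local Notation S := (solenoid R).

Lemma continuous_coordinate n : continuous (fun u : S => set_val u n : C).
Proof.
move=> u; apply: (@continuous_comp S (prod_topology (fun _ : nat => C)) C
  (@set_val _ (@solenoid_set R)) (fun v => v n)).
  exact: initial_continuous.
exact: (@proj_continuous _ (fun _ : nat => C) n).
Qed.

Lemma continuous_proj_level N : continuous (@proj_level R N).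
Proof. exact: continuous_coordinate. Qed.

Lemma continuous_chi q : continuous (@chi R q).
Proof.
rewrite /chi; case: (numq q) => n.
  by apply: continuous_expr; exact: continuous_proj_level.
apply: (@continuous_inv R S (fun u => proj_level `|denq q|%N u ^+ n.+1)) => [u|].
  by rewrite expf_neq0// proj_level_neq0.
by apply: continuous_expr; exact: continuous_proj_level.
Qed.

(** A Wiener function is a uniform limit of finite sums of characters. *)
Lemma continuous_wiener_in A M (f : S -> C) : wiener_in A M f -> continuous f.
Proof.
move=> fA; apply/continuous_modulusP => u e e0; have e3 : 0 < e / 3 by rewrite divr_gt0.
have [F [a hF]] := wiener_in_approx e3 fA.
set p := fun u : S => \sum_(q <- F) a q * chi q u.
have cp : continuous p.
  apply: (@continuous_sum R S rat F (fun q u => a q * chi q u)) => q.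
  apply: (@continuous_mul R S (fun=> a q) (@chi R q)).
    exact: continuous_constant.
  exact: continuous_chi.
move/continuous_modulusP: cp => /(_ u _ e3); apply: filterS => v hv.
have h1 := wiener_in_le v hF; have h2 := wiener_in_le u hF.
exact: modulus_lt_thirds h1 h2 hv.
Qed.

Lemma continuous_line : continuous (@line R).
Proof.
apply: continuous_comp_initial => t; apply/cvg_sup => n.
apply/cvg_image.
  by apply/seteqP; split=> // z _; exists (fun=> z).
move=> A /= An; exists [set v : nat -> C | A (v n)]; last first.
  by apply/seteqP; split=> [z [v Av <-]//|z Az]; exists (fun=> z).
rewrite /= /nbhs /=.
have ct : continuous (fun t : R => cis (t / n.+1%:R)).
  move=> s; apply: continuous_comp; last exact: continuous_cis.
  by apply: cvgM; [exact: cvg_id|exact: cvg_cst].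
exact: (ct t A An).
Qed.

Lemma compact_circle : compact (@circle R).
Proof.
have -> : @circle R = @cis R @` [set` `[- pi, pi] ].
  apply/seteqP; split=> z /=.
    by move=> /circleP/cis_surj[t tpi ->]; exists t; rewrite //= in_itv.
  by move=> [t _ <-]; apply/circleP; exact: modulus_cis.
apply: continuous_compact; last exact: segment_compact.
by apply: continuous_subspaceT => t; exact: continuous_cis.
Qed.

(** A closed subset of a product of circles. *)
Lemma compact_solenoid_set : compact (@solenoid_set R).
Proof.
have cc := @tychonoff nat (fun=> C) (fun=> @circle R) (fun=> compact_circle).
apply: (@subclosed_compact _ _ _ _ cc); last by move=> u [].
have -> : @solenoid_set R = [set u | forall i, circle (u i)] `&`
    \bigcap_(mn in [set mn : nat * nat | (mn.2.+1 %| mn.1.+1)%N])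
      [set u : prod_topology (fun _ : nat => C) |
        u mn.2 - u mn.1 ^+ (mn.1.+1 %/ mn.2.+1) = 0].
  apply/seteqP; split=> u /= [h1 h2]; split=> //.
    by move=> [m n] /= mn; rewrite (h2 _ _ mn) subrr.
  by move=> m n mn; apply/eqP; rewrite -subr_eq0; apply/eqP/(h2 (m, n)).
apply: closedI.
  apply: compact_closed cc; apply: hausdorff_product => ?.
  exact: norm_hausdorff.
apply: closed_bigI => -[m n] _ /=.
have pc k : continuous (fun u : prod_topology (fun _ : nat => C) => u k).
  exact: (@proj_continuous _ (fun _ : nat => C) k).
pose P := prod_topology (fun _ : nat => C).
apply: (@closed_comp P C (fun u => u n - u m ^+ (m.+1 %/ n.+1)) [set 0]).
  move=> u _; apply: (@continuous_sub R P (fun u => u n)); first exact: pc.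
  exact: (@continuous_expr R P (fun u => u m) _ (pc m)).
exact/accessible_closed_set1/hausdorff_accessible/norm_hausdorff.
Qed.

(** Compactness passes from the subset to the subtype by pushing covers forward
    along the inclusion. *)
Lemma compact_solenoid : compact [set: S].
Proof.
apply/compact_near_coveringP => J F P FF cover.
have /compact_near_coveringP nc := compact_solenoid_set.
have := nc J F (fun i x => forall u : S, set_val u = x -> P i u) FF.
have key x : @solenoid_set R x -> \forall x' \near x & i \near F,
    forall u : S, set_val u = x' -> P i u.
  move=> Sx; pose ux : S := exist (fun u => u \in @solenoid_set R) _ (mem_set Sx).
  have [[/= A B] [nA FB] AB] := cover ux I. 
  move: nA => [_] /= [[W oW <-] Wx WA].
  exists (W, B); first by split=> //; exact: open_nbhs_nbhs.
  move=> [x' i] /= [Wx' Bi] u ux'; apply: (AB (u, i)); split=> //=.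
  by apply: WA; rewrite /= ux'.
move=> /(_ key); apply: filterS => i h u _.
by apply: (h (set_val u)) => //; exact: set_valP.
Qed.

End SolenoidTopology.
(** * Neumann series and one-sided equations *)

Section Splitting.
Variable R : realType.
Local Notation C := (Cplx R).
Local Notation S := (solenoid R).

Lemma has_sum_nat_shift (a : nat -> C) t :
  has_sum a t -> has_sum (fun n => a n.+1) (t - a 0%N).
Proof.
move=> h e e0; have [F hF] := h e e0; exists (map predn F) => G uG sG.
have /(hF (0%N :: map succn G)) : uniq (0%N :: map succn G).
  rewrite /= map_inj_uniq//; last exact: succn_inj.
  by rewrite uG andbT; apply/mapP => -[].
rewrite big_cons big_map => hG.
have -> : \sum_(i <- G) a i.+1 - (t - a 0%N)
    = a 0%N + \sum_(i <- G) a i.+1 - t by ring.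
apply: hG => -[|n] nF; first exact: mem_head.
by rewrite inE map_f// sG//; exact: (map_f predn nF).
Qed.

Lemma bounded_sums_geometric (rho : R) : 0 <= rho -> rho < 1 ->
  bounded_sums (fun n : nat => rho ^+ n) (1 / (1 - rho)).
Proof.
move=> r0 r1 s us; pose N := (\max_(i <- s) i).+1.
have sN : {subset s <= iota 0 N}.
  by move=> i si; rewrite mem_iota /= add0n ltnS (leq_bigmax_seq (F := id)).
have r0n (i : nat) : 0 <= rho ^+ i by rewrite exprn_ge0.
rewrite (le_trans (bounded_sums_subset r0n us (iota_uniq 0 N) sN))//.
rewrite ler_pdivlMr ?subr_gt0// mulrC.
have -> : iota 0 N = index_iota 0 N by rewrite /index_iota subn0.
have := subrX1 rho N; rewrite big_mkord => /(congr1 -%R).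
rewrite opprB -mulNr opprB => <-.
by rewrite lerBlDr lerDl.
Qed.

Lemma wiener_inX A rho (r : S -> C) n : A 0 -> (forall p q, A p -> A q -> A (p + q)) ->
  wiener_in A rho r -> wiener_in A (rho ^+ n) (fun u => r u ^+ n).
Proof.
move=> A0 AD rA; elim: n => [|n IH].
  by rewrite expr0 -(modulus1 R); exact: wiener_in_cst.
rewrite exprS; have -> : (fun u => r u ^+ n.+1) = (fun u => r u * r u ^+ n).
  by apply/funext => u; rewrite exprS.
exact: wiener_inM AD rA IH.
Qed.

(** The geometric series of [r], which stays in the subalgebra of [A]. *)
Lemma wiener_in_Neumann A rho (r : S -> C) :
  A 0 -> (forall p q, A p -> A q -> A (p + q)) -> wiener_in A rho r -> rho < 1 ->
  exists x M, wiener_in A M x /\ forall u, (1 - r u) * x u = 1.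
Proof.
move=> A0 AD rA rho1; have rho0 := wiener_in_ge0 rA.
have [x xA hx] := wiener_in_sum (fun n => wiener_inX n A0 AD rA)
  (bounded_sums_geometric rho0 rho1).
exists x, (1 / (1 - rho)); split=> // u.
have h1 := has_sumZ (r u) (hx u).
have h2 := has_sum_nat_shift (hx u).
have E : r u * x u = x u - 1.
  rewrite -(expr0 (r u)); apply: has_sum_unique h1 _; move: h2.
  by congr has_sum; apply/funext => n; rewrite exprS.
by rewrite mulrBl mul1r E; ring.
Qed.

Let nonneg : set rat := [set q | 0 <= q].
Let nonpos : set rat := [set q | q <= 0].

(** The equation [(1 - r) x = 1 - z] with [x] supported in the nonnegative and
    [z] in the nonpositive frequencies. Starting from [x_0 = 1], split
    [r x_n = x_(n+1) + z_n] into its nonnegative and negative halves, each of norm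
    at most [rho ^ n.+1]; summing over [n] gives [r x = x - 1 + z] for
    [x = sum x_n] and [z = sum z_n]. The conclusion uses [y = x - 1]. *)
Lemma Toeplitz_solution rho (r : S -> C) :
  wiener_in setT rho r -> rho < 1 ->
  exists y z, [/\ wiener_in nonneg (rho / (1 - rho)) y,
    wiener_in nonpos (rho / (1 - rho)) z &
    forall u, (1 - r u) * (1 + y u) = 1 - z u].
Proof.
move=> rW rho1; have rho0 := wiener_in_ge0 rW.
have /choice[step hstep] : forall p : nat * (S -> C), exists y : (S -> C) * (S -> C),
    wiener_in nonneg (rho ^+ p.1) p.2 ->
    [/\ wiener_in nonneg (rho ^+ p.1.+1) y.1, wiener_in nonpos (rho ^+ p.1.+1) y.2 &
      forall u, r u * p.2 u = y.1 u + y.2 u].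
  move=> [n f] /=; have [fn|fn] := pselect (wiener_in nonneg (rho ^+ n) f); last first.
    by exists (f, f).
  have : wiener_in (nonneg `|` nonpos) (rho ^+ n.+1) (fun u => r u * f u).
    rewrite exprS; apply: wiener_inM rW fn => p q _ _.
    by have [|/ltW] := leP 0 (p + q); [left|right].
  by move=> /wiener_in_split[f1 [f2 [h1 h2 h3]]]; exists (f1, f2).
(* [X n] and [Z n] are [x_n] and [z_n] *)
pose X := fix X n : S -> C := if n is m.+1 then (step (m, X m)).1 else fun=> 1.
pose Z n := (step (n, X n)).2.
have XW n : wiener_in nonneg (rho ^+ n) (X n).
  elim: n => [|n IH] /=; last by have [] := hstep (n, X n) IH.
  by rewrite expr0 -(modulus1 R); apply: wiener_in_cst; rewrite /nonneg /= lexx.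
have ZW n : wiener_in nonpos (rho ^+ n.+1) (Z n).
  by have [] := hstep (n, X n) (XW n).
have rX n u : r u * X n u = X n.+1 u + Z n u.
  by have [_ _] := hstep (n, X n) (XW n); exact.
have geo : bounded_sums (fun n : nat => rho ^+ n.+1) (rho / (1 - rho)).
  have -> : (fun n : nat => rho ^+ n.+1) = (fun n => rho * rho ^+ n).
    by apply/funext => n; rewrite exprS.
  rewrite -[1 - rho]invrK -[_^-1^-1]mul1r invrK.
  apply: bounded_sumsZ => //; exact: bounded_sums_geometric.
have [y yW hy] := wiener_in_sum (fun n => XW n.+1) geo.
have [z zW hz] := wiener_in_sum ZW geo.
exists y, z; split=> // u.
have h1 := has_sumZ (r u) (hy u).
have h2 := has_sumD (has_sum_nat_shift (hy u)) (has_sum_nat_shift (hz u)).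
have E : r u * y u = (y u - X 1%N u) + (z u - Z 0%N u).
  apply: has_sum_unique h1 _; move: h2.
  by congr has_sum; apply/funext => n; rewrite rX.
have E0 := rX 0%N u; rewrite /= mulr1 in E0.
rewrite mulrDr mulr1 mulrBl mul1r E E0; rewrite /=; ring.
Qed.

End Splitting.

(** * Null-homotopic maps to the punctured plane *)

Section NullHomotopic.
Variables (R : realType) (X : topologicalType).
Local Notation C := (Cplx R).
Implicit Types f g : X -> C.

(** Continuity and nonvanishing of [G] are required on the unit interval only, so
    that affine homotopies qualify as they stand. *)
Definition null_homotopic f := exists G : X * R -> C,
  [/\ forall u t, 0 <= t <= 1 -> {for (u, t), continuous G},
      forall u t, 0 <= t <= 1 -> G (u, t) != 0,
      forall u, G (u, 0) = f u & forall u, G (u, 1) = 1].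

Lemma null_homotopicM f g : null_homotopic f -> null_homotopic g ->
  null_homotopic (fun u => f u * g u).
Proof.
move=> [F [F1 F2 F3 F4]] [G [G1 G2 G3 G4]]; exists (fun x => F x * G x); split.
- by move=> u t t01; apply: cvgM; [exact: F1|exact: G1].
- by move=> u t t01; rewrite mulf_neq0// ?F2 ?G2.
- by move=> u; rewrite F3 G3.
- by move=> u; rewrite F4 G4 mulr1.
Qed.

Lemma null_homotopicV f : null_homotopic f -> null_homotopic (fun u => (f u)^-1).
Proof.
move=> [F [F1 F2 F3 F4]]; exists (fun x => (F x)^-1); split.
- by move=> u t t01; apply: cvgV; [exact: F2|exact: F1].
- by move=> u t t01; rewrite invr_neq0// F2.
- by move=> u; rewrite F3.
- by move=> u; rewrite F4 invr1.
Qed.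

(** The segment from a point of the closed right half plane to [1] meets [0] only
    if the point is [0]. *)
Lemma null_homotopic_half_plane f : continuous f ->
  (forall u, f u != 0) -> (forall u, 0 <= complex.Re (f u)) -> null_homotopic f.
Proof.
move=> cf f0 Ref; exists (fun x => x.2%:C%C + (1 - x.2)%:C%C * f x.1); split.
- move=> u t _; have c2 : (fun x : X * R => x.2) @ (u, t) --> t by exact: cvg_snd.
  apply: cvgD; first exact: cvg_realC.
  apply: cvgM.
    by apply: cvg_realC; apply: cvgB => //; exact: cvg_cst.
  by apply: (@cvg_comp _ _ _ _ f _ (nbhs u)); [exact: cvg_fst|exact: cf].
- move=> u t /andP[t0 t1] /=; apply/eqP => E.
  have := congr1 (@complex.Re R) E; case Eu: (f u) (Ref u) (f0 u) => [x y] /= x0.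
  rewrite mul0r subr0 => u0 E0.
  have t00 : t = 0.
    have := mulr_ge0 (_ : 0 <= 1 - t) x0; rewrite subr_ge0 => /(_ t1).
    by lra.
  by move: E; rewrite Eu t00 subr0 add0r mul1r => /eqP; rewrite (negbTE u0).
- by move=> u /=; rewrite subr0 add0r mul1r.
- by move=> u /=; rewrite subrr mul0r addr0.
Qed.

(** A nonzero constant has a square root in the closed right half plane. *)
Lemma null_homotopic_constant (c : C) : c != 0 -> null_homotopic (fun=> c).
Proof.
move=> c0; have [d d0 [Red ->]] : exists2 d : C, d != 0 & 0 <= complex.Re d /\ c = d * d.
  exists (sqrtc c); first by rewrite sqrtc_eq0.
  by rewrite -[_ * _]expr2 sqr_sqrtc; split=> //; case: c {c0} => a b; exact: sqrtr_ge0.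
by apply: null_homotopicM; apply: null_homotopic_half_plane => // x; exact: cvg_cst.
Qed.

Lemma null_homotopic_near1 (h : X -> C) : continuous h ->
  (forall u, modulus (h u) < 1) -> null_homotopic (fun u => 1 - h u).
Proof.
move=> ch h1; have Re0 u : 0 < complex.Re (1 - h u).
  rewrite raddfB subr_gt0 /=; apply: le_lt_trans (h1 u).
  by rewrite (le_trans (ler_norm _))// Re_le_modulus.
apply: null_homotopic_half_plane => [x|u|u]; last exact: ltW.
  by apply: cvgB; [exact: cvg_cst|exact: ch].
by apply/eqP => E; have := Re0 u; rewrite E ltxx.
Qed.

Lemma null_homotopic_homotopic (k f : X -> C) :
  continuous k -> (forall u, modulus (k u) = 1) -> null_homotopic f ->
  homotopic_in R (@circle R) (fun u => f u * k u / `|f u * k u| : C) k.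
Proof.
move=> ck k1 [G [G1 G2 G3 G4]].
exists (fun x => G x * k x.1 / (modulus (G x))%:C%C); split.
- apply: continuous_in_subspaceT => -[u t] /set_mem[_ /=].
  rewrite in_itv /= => t01; apply: cvgM.
    apply: cvgM; first exact: G1.
    by apply: (@cvg_comp _ _ _ _ k _ (nbhs u)); [exact: cvg_fst|exact: ck].
  apply: cvgV; first by rewrite fmorph_eq0 modulus_eq0 G2.
  by apply: cvg_realC; apply: cvg_modulus; exact: G1.
- move=> u t t01; apply/circleP; rewrite !modulusM modulusV modulus_real k1 mulr1.
  by rewrite ger0_norm ?modulus_ge0// divff// modulus_eq0 G2.
- by move=> u; rewrite /= G3 modulusE modulusM k1 mulr1.
- by move=> u; rewrite /= G4 modulus1 mul1r divr1.
Qed.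

End NullHomotopic.
(** * Factorization of units and uniqueness of the exponent *)

Section Factorization.
Variable R : realType.
Local Notation C := (Cplx R).
Local Notation S := (solenoid R).
Implicit Types (f g : S -> C) (p q : rat).

Lemma nonposD p q : p <= 0 -> q <= 0 -> p + q <= 0.
Proof. by move=> p0 q0; lra. Qed.

Lemma wienerP f : wiener f <-> exists M, wiener_in setT M f.
Proof.
split=> [[a /wiener_expansionP[[M aM] h]]|[M [a [a1 a2 _]]]].
  by exists M, a.
by exists a; apply/wiener_expansionP; split=> //; exists M.
Qed.

Lemma wiener_plusP f : wiener_plus f <-> exists M, wiener_in [set q | 0 <= q] M f.
Proof.
split=> [[a /wiener_expansionP[[M aM] h] a0]|[M [a [a1 a2 a3]]]].
  by exists M, a; split=> // q; apply: contraR; rewrite -ltNge => /a0/eqP.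
exists a; first by apply/wiener_expansionP; split=> //; exists M.
by move=> q q0; apply/eqP; apply: contraLR q0 => /a3; rewrite -leNgt.
Qed.

Lemma wiener_minusP f : wiener_minus f <-> exists M, wiener_in [set q | q <= 0] M f.
Proof.
split=> [[a /wiener_expansionP[[M aM] h] a0]|[M [a [a1 a2 a3]]]].
  by exists M, a; split=> // q; apply: contraR; rewrite -ltNge => /a0/eqP.
exists a; first by apply/wiener_expansionP; split=> //; exists M.
by move=> q q0; apply/eqP; apply: contraLR q0 => /a3; rewrite -leNgt.
Qed.

Lemma wiener_plusM f g : wiener_plus f -> wiener_plus g ->
  wiener_plus (fun u => f u * g u).
Proof.
move=> /wiener_plusP[M fM] /wiener_plusP[N gN]; apply/wiener_plusP; exists (M * N).
by apply: wiener_inM fM gN => p q /=; exact: addr_ge0.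
Qed.

Lemma wiener_minusM f g : wiener_minus f -> wiener_minus g ->
  wiener_minus (fun u => f u * g u).
Proof.
move=> /wiener_minusP[M fM] /wiener_minusP[N gN]; apply/wiener_minusP; exists (M * N).
by apply: wiener_inM fM gN => p q /=; exact: nonposD.
Qed.

Lemma wiener_plus_constant (c : C) : wiener_plus (fun _ : S => c).
Proof. by apply/wiener_plusP; exists (modulus c); apply: wiener_in_cst; exact: lexx. Qed.

Lemma wiener_minus_constant (c : C) : wiener_minus (fun _ : S => c).
Proof. by apply/wiener_minusP; exists (modulus c); apply: wiener_in_cst; exact: lexx. Qed.

Lemma units_ofM (A : set (S -> C)) f g :
  (forall f g, A f -> A g -> A (fun u => f u * g u)) ->
  units_of A f -> units_of A g -> units_of A (fun u => f u * g u).
Proof.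
move=> AM [Af [f' Af' ff']] [Ag [g' Ag' gg']]; split; first exact: AM.
exists (fun u => f' u * g' u); first exact: AM.
by move=> u; rewrite mulrACA ff' gg' mulr1.
Qed.

Lemma units_ofV (A : set (S -> C)) f : units_of A f -> units_of A (fun u => (f u)^-1).
Proof.
move=> [Af [g Ag fg]]; have E : (fun u => (f u)^-1) = g.
  apply/funext => u; have f0 : f u != 0.
    by apply: contraPneq (fg u) => ->; rewrite mul0r => /eqP; rewrite eq_sym oner_eq0.
  by apply: (mulfI f0); rewrite fg divff.
by rewrite E; split=> //; exists f => // u; rewrite mulrC fg.
Qed.

Lemma units_of_neq0 (A : set (S -> C)) f u : units_of A f -> f u != 0.
Proof.
move=> [_ [g _ fg]]; apply: contraPneq (fg u) => ->.
by rewrite mul0r => /eqP; rewrite eq_sym oner_eq0.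
Qed.

(** The null-homotopy of [fm fp] identifies [q] with the winding number of [f]. *)
Definition factorizes f := exists q fm fp,
  is_factorization f fm q fp /\ null_homotopic (fun u => fm u * fp u).

Lemma factorizesM f g : factorizes f -> factorizes g -> factorizes (fun u => f u * g u).
Proof.
move=> [q [fm [fp [[fm1 fp1 fE] f0]]]] [q' [gm [gp [[gm1 gp1 gE] g0]]]].
exists (q + q'), (fun u => fm u * gm u), (fun u => fp u * gp u).
split; first split.
- exact: units_ofM wiener_minusM fm1 gm1.
- exact: units_ofM wiener_plusM fp1 gp1.
- by move=> u; rewrite fE gE chiD; ring.
- have := null_homotopicM f0 g0; congr null_homotopic.
  by apply/funext => u; ring.
Qed.

Lemma factorizesV f : factorizes f -> factorizes (fun u => (f u)^-1).
Proof.
move=> [q [fm [fp [[fm1 fp1 fE] f0]]]].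
exists (- q), (fun u => (fm u)^-1), (fun u => (fp u)^-1); split; first split.
- exact: units_ofV.
- exact: units_ofV.
- by move=> u; rewrite fE chiN !invfM.
- have := null_homotopicV f0; congr null_homotopic.
  by apply/funext => u; rewrite invfM.
Qed.

Lemma factorizes_plus f : units_of (@wiener_plus R) f -> null_homotopic f -> factorizes f.
Proof.
move=> f1 f0; exists 0, (fun=> 1), f; split; first split=> //.
- split; first exact: wiener_minus_constant.
  by exists (fun=> 1) => [|u]; rewrite ?mulr1//; exact: wiener_minus_constant.
- by move=> u; rewrite chi0 !mul1r.
- by move: f0; congr null_homotopic; apply/funext => u; rewrite mul1r.
Qed.

Lemma factorizes_minus f : units_of (@wiener_minus R) f -> null_homotopic f -> factorizes f.
Proof.
move=> f1 f0; exists 0, f, (fun=> 1); split; first split=> //.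
- split; first exact: wiener_plus_constant.
  by exists (fun=> 1) => [|u]; rewrite ?mulr1//; exact: wiener_plus_constant.
- by move=> u; rewrite chi0 !mulr1.
- by move: f0; congr null_homotopic; apply/funext => u; rewrite mulr1.
Qed.

Lemma factorizes_constant (c : C) : c != 0 -> factorizes (fun=> c).
Proof.
move=> c0; apply: factorizes_plus; last exact: null_homotopic_constant.
split; first exact: wiener_plus_constant.
by exists (fun=> c^-1) => [|u]; rewrite ?divff//; exact: wiener_plus_constant.
Qed.

Lemma factorizes_chi q : factorizes (@chi R q).
Proof.
exists q, (fun=> 1), (fun=> 1); split; first split=> //.
- split; first exact: wiener_minus_constant.
  by exists (fun=> 1) => [|u]; rewrite ?mulr1//; exact: wiener_minus_constant.
- split; first exact: wiener_plus_constant.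
  by exists (fun=> 1) => [|u]; rewrite ?mulr1//; exact: wiener_plus_constant.
- by move=> u; rewrite mulr1 mul1r.
- have := @null_homotopic_constant R S 1 (oner_neq0 _); congr null_homotopic.
  by apply/funext => u; rewrite mulr1.
Qed.

Lemma null_homotopic_wiener A rho (h : S -> C) : wiener_in A rho h -> rho < 1 ->
  null_homotopic (fun u => 1 - h u).
Proof.
move=> hA rho1; apply: null_homotopic_near1 => [|u].
  exact: continuous_wiener_in hA.
exact: le_lt_trans (wiener_in_le u hA) rho1.
Qed.

Lemma factorizes_plus_near1 rho (h : S -> C) : wiener_in [set q | 0 <= q] rho h -> rho < 1 ->
  factorizes (fun u => 1 - h u).
Proof.
move=> hA rho1; apply: factorizes_plus; last exact: null_homotopic_wiener hA rho1.
have [x [M [xM hx]]] := wiener_in_Neumann (lexx _) (@addr_ge0 _) hA rho1.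
split; last by exists x => //; apply/wiener_plusP; exists M.
by apply/wiener_plusP; exists (1 + rho); apply: wiener_in_1B => //; exact: lexx.
Qed.

Lemma factorizes_minus_near1 rho (h : S -> C) : wiener_in [set q | q <= 0] rho h -> rho < 1 ->
  factorizes (fun u => 1 - h u).
Proof.
move=> hA rho1; apply: factorizes_minus; last exact: null_homotopic_wiener hA rho1.
have [x [M [xM hx]]] := wiener_in_Neumann (lexx _) nonposD hA rho1.
split; last by exists x => //; apply/wiener_minusP; exists M.
by apply/wiener_minusP; exists (1 + rho); apply: wiener_in_1B => //; exact: lexx.
Qed.

Lemma chi_natmul n q (u : S) : chi (n%:R * q) u = chi q u ^+ n.
Proof.
elim: n => [|n IH]; first by rewrite mul0r chi0.
by rewrite -natr1 mulrDl mul1r chiD IH exprSr.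
Qed.

(** The shift [m] makes all numerators natural numbers, so that a finite character
    sum is a genuine polynomial in [chi N^-1], up to one character. *)
Lemma common_denominator_seq (F : seq rat) : exists N m : nat, (0 < N)%N /\
  {in F, forall q, exists n : nat, q = (n%:R - m%:R) / N%:R}.
Proof.
elim: F => [|q F [N [m [N0 h]]]]; first by exists 1%N, 0%N.
pose b := `|denq q|%N; pose a := `|numq q|%N.
have b0 : (0 < b)%N by rewrite absz_gt0 denq_neq0.
have N0' : N%:R != 0 :> rat by rewrite pnatr_eq0 -lt0n.
have b0' : b%:R != 0 :> rat by rewrite pnatr_eq0 -lt0n.
exists (N * b)%N, (m * b + a * N)%N; split; first by rewrite muln_gt0 N0.
move=> p; rewrite inE => /orP[/eqP ->{p}|/h[n ->]]; last first.
  exists (n * b + a * N)%N; rewrite !natrD !natrM.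
  by field; rewrite b0' N0'.
pose k : int := numq q * N%:Z + (m * b + a * N)%N%:Z.
have k0 : 0 <= k.
  have h1 : 0 <= numq q + a%:Z by rewrite /a abszE -lerBlDr sub0r lerNl -normrN ler_norm.
  have -> : k = (numq q + a%:Z) * N%:Z + (m * b)%N%:Z.
    by rewrite /k PoszD [(a * N)%N%:Z]PoszM; ring.
  by rewrite addr_ge0// mulr_ge0.
have E : (`|k|%N)%:R = (numq q)%:~R * N%:R + (m * b + a * N)%N%:R :> rat.
  by rewrite pmulrn gez0_abs// /k rmorphD rmorphM.
exists `|k|%N; rewrite E addrK natrM -mulf_div.
have qE : q = (numq q)%:~R / b%:R by rewrite pmulrn gez0_abs// divq_num_den.
by rewrite {1}qE mulrA divfK.
Qed.

(** With [z = chi N^-1], factor [z - c] as [z (1 - c / z)] if [c] is inside the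
    circle, and as [- c (1 - z / c)] if it is outside. *)
Lemma factorizes_linear (N : nat) (c : C) : (0 < N)%N -> modulus c != 1 ->
  factorizes (fun u : S => chi N%:R^-1 u - c).
Proof.
move=> N0 c1; have Ni : 0 <= N%:R^-1 :> rat by rewrite invr_ge0.
have [c_lt1|c_gt1|/eqP] := ltgtP (modulus c) 1; last by rewrite (negbTE c1).
- have -> : (fun u : S => chi N%:R^-1 u - c)
      = (fun u => chi N%:R^-1 u * (1 - c * chi (- N%:R^-1) u)).
    apply/funext => u; rewrite mulrBr mulr1 mulrCA -chiD.
    by rewrite addrN chi0 mulr1.
  apply: factorizesM; first exact: factorizes_chi.
  apply: (@factorizes_minus_near1 (modulus c)) => //.
  by apply: wiener_in_chi; rewrite /= oppr_le0.
- have c0 : c != 0 by rewrite -modulus_eq0; apply/eqP => E; move: c_gt1; rewrite E; lra.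
  have -> : (fun u : S => chi N%:R^-1 u - c)
      = (fun u => - c * (1 - c^-1 * chi N%:R^-1 u)).
    by apply/funext => u; rewrite mulrBr mulr1 mulNr mulVKf// opprK addrC.
  apply: factorizesM; first by apply: factorizes_constant; rewrite oppr_eq0.
  apply: (@factorizes_plus_near1 (modulus c^-1)); first exact: wiener_in_chi.
  by rewrite modulusV invf_lt1// (lt_trans ltr01).
Qed.

(** The roots of the associated polynomial avoid the circle. *)
Lemma factorizes_finite (F : seq rat) (a : rat -> C) :
  (forall u : S, \sum_(q <- F) a q * chi q u != 0) ->
  factorizes (fun u : S => \sum_(q <- F) a q * chi q u).
Proof.
move=> p0; have [N [m [N0 hF]]] := common_denominator_seq F.
have /choice[n hn] : forall q, exists n : nat, q \in F -> q = (n%:R - m%:R) / N%:R.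
  move=> q; have [/hF[n]|_] := boolP (q \in F); first by exists n.
  by exists 0%N.
pose P : {poly R[i]} := \sum_(q <- F) (a q : R[i]) *: 'X^(n q).
pose z (u : S) := chi N%:R^-1 u; pose s := - (m%:R / N%:R) : rat.
have PE u : \sum_(q <- F) a q * chi q u = P.[z u] * chi s u.
  rewrite horner_sum mulr_suml; apply: eq_big_seq => q qF.
  rewrite hornerZ hornerXn -mulrA; congr (_ * _).
  by rewrite {1}(hn q qF) mulrBl chiD chi_natmul.
have [r Pr] := closed_field_poly_normal P.
have PzE x : P.[x] = lead_coef P * \prod_(c <- r) (x - c).
  rewrite {1}Pr hornerZ horner_prod; congr (_ * _).
  by apply: eq_bigr => c _; rewrite hornerXsubC.
have r1 c : c \in r -> modulus c != 1.
  move=> cr; apply/eqP => /(chi_surj N0)[u uc]; have := p0 u.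
  by rewrite PE PzE /z uc (big_rem c)//= subrr mul0r mulr0 mul0r eqxx.
have lc0 : lead_coef P != 0.
  apply/eqP => E; have := p0 (line 0).
  by rewrite PE PzE E !mul0r eqxx.
have -> : (fun u : S => \sum_(q <- F) a q * chi q u)
    = (fun u => (lead_coef P : C) * (\prod_(c <- r) (z u - c)) * chi s u).
  by apply/funext => u; rewrite PE PzE.
apply: factorizesM; last exact: factorizes_chi.
apply: factorizesM; first exact: factorizes_constant.
elim: r {Pr PzE} r1 => [_|c r IH r1].
  under eq_fun do rewrite big_nil.
  exact: (factorizes_constant (oner_neq0 _)).
under eq_fun do rewrite big_cons.
apply: factorizesM; first by apply: factorizes_linear => //; apply: r1; exact: mem_head.
by apply: IH => x xr; apply: r1; rewrite inE xr orbT.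
Qed.

(** Approximate [f] by a finite sum [p] so closely that [w = f^-1 (f - p)] has norm
    at most [1 / 3]. Then [p = f (1 - w)], and the one-sided equation
    [(1 - w) (1 + y) = 1 - z] gives [f = p (1 + y) / (1 - z)] with [y] and [z] of norm
    at most [(1 / 3) / (1 - 1 / 3) = 1 / 2]. *)
Lemma factorizes_unit f : units_of (@wiener R) f -> factorizes f.
Proof.
move=> [/wienerP[M fM] [g /wienerP[L gL] fg]].
(* [K > 0] even if [L = 0] *)
pose K := L + 1; have L0 := wiener_in_ge0 gL.
have K0 : 0 < K by rewrite ltr_wpDl.
have e0 : 0 < 1 / (3 * K) by rewrite divr_gt0// mulr_gt0.
have [F [a hF]] := wiener_in_approx e0 fM.
set p := fun u : S => \sum_(q <- F) a q * chi q u.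
have hw : wiener_in setT (L * (1 / (3 * K))) (fun u => g u * (f u - p u)).
  by apply: wiener_inM gL hF.
have w3 : L * (1 / (3 * K)) <= 1 / 3.
  rewrite mul1r invfM mulrCA mulrA ler_pdivrMr// mul1r.
  by rewrite ler_wpM2l// /K lerDl.
have {hw} hw := wiener_inW (@subset_refl _ setT) w3 hw.
set w := (fun u => g u * (f u - p u)) in hw.
have pE u : p u = f u * (1 - w u).
  rewrite /w mulrBr mulr1 mulrA fg mul1r; ring.
have w1 : 1 / 3 < 1 :> R by lra.
have f0 u : f u != 0.
  by apply: contraPneq (fg u) => ->; rewrite mul0r => /eqP; rewrite eq_sym oner_eq0.
have [y [z [yW zW yz]]] := Toeplitz_solution hw w1.
have E : 1 / 3 / (1 - 1 / 3) = 1 / 2 :> R by field.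
rewrite E in yW zW; have h2 : 1 / 2 < 1 :> R by lra.
have w_neq1 u : 1 - w u != 0.
  rewrite subr_eq0; apply/eqP => w1'; have := wiener_in_le u hw.
  by rewrite -w1' modulus1; lra.
have p0 u : p u != 0 by rewrite pE mulf_neq0.
have z0 u : 1 - z u != 0.
  rewrite subr_eq0; apply/eqP => z1; have := wiener_in_le u zW.
  by rewrite -z1 modulus1; lra.
have -> : f = (fun u => p u * (1 - - y u) * (1 - z u)^-1).
  apply/funext => u; apply: (mulIf (z0 u)).
  by rewrite mulfVK// opprK -yz mulrA -pE.
apply: factorizesM; first apply: factorizesM.
- exact: factorizes_finite.
- exact: factorizes_plus_near1 (wiener_inN yW) h2.
- exact: factorizesV (factorizes_minus_near1 zW h2).
Qed.

(** Dividing two factorizations of [f] with exponents [q < q'] equates a function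
    with frequencies at most [0] with one whose frequencies are at least
    [q' - q > 0]; such a function vanishes, yet it is a product of units. *)
Lemma factorization_exponent_le f q q' fm fp fm' fp' :
  is_factorization f fm q fp -> is_factorization f fm' q' fp' -> q' <= q.
Proof.
move=> [um up E] [um' up' E']; rewrite leNgt; apply/negP => qq'.
have [/wiener_minusP[M1 h1] _] := units_ofM wiener_minusM um (units_ofV um').
have [/wiener_plusP[M2 h2] _] := units_ofM wiener_plusM up' (units_ofV up).
have {h2} h2 : wiener_in [set q | 0 < q] (modulus (1 : C) * M2)
    (fun u => 1 * chi (q' - q) u * (fp' u * (fp u)^-1)).
  by apply: wiener_in_shift h2 => p /= p0; rewrite ltr_wpDr// subr_gt0.
have nz u : fm u * (fm' u)^-1 != 0.
  by rewrite mulf_neq0 ?invr_eq0 ?(units_of_neq0 _ um) ?(units_of_neq0 _ um').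
have EE : (fun u => 1 * chi (q' - q) u * (fp' u * (fp u)^-1))
    = (fun u => fm u * (fm' u)^-1).
  apply/funext => u; rewrite mul1r chiD chiN.
  have n1 := units_of_neq0 u um; have n2 := units_of_neq0 u um'.
  have n3 := units_of_neq0 u up; have n4 := units_of_neq0 u up'.
  have n5 := chi_neq0 q u.
  have := E u; rewrite E' => e.
  apply: (mulfI n2); apply: (mulIf n3); apply: (mulIf n5).
  have -> : fm' u * (fm u / fm' u) * fp u * chi q u = fm u * chi q u * fp u.
    by field.
  by rewrite -e; field; rewrite n5 n3.
rewrite EE in h2; have := nz (line 0).
rewrite (wiener_in_disjoint _ h1 h2) ?eqxx// => p /= p0.
by apply/negP; rewrite -leNgt.
Qed.

End Factorization.
(** * Phases of homotopies over a compact base *)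

Section HomotopyLifting.
Variables (R : realType) (X : topologicalType).
Local Notation C := (Cplx R).
Local Notation cylinder := ([set: X] `*` [set` `[0%R : R, 1%R]]).

Lemma cylinderP (u : X) (t : R) : cylinder (u, t) <-> 0 <= t <= 1.
Proof. by rewrite /= in_itv /=; split=> [[]|]. Qed.

Lemma homotopy_slice (H : X * R -> C) t : {within cylinder, continuous H} ->
  0 <= t <= 1 -> continuous (fun u => H (u, t)).
Proof.
move=> /subspace_continuousP cH t01; apply/continuous_modulusP => u e e0.
have /cvg_modulusP /(_ e e0) := cH (u, t) (proj2 (cylinderP u t) t01).
rewrite /prop_near1 /within /= => hU.
have ct : (fun v : X => (v, t)) @ u --> (u, t).
  exact: (@cvg_pair _ _ _ (nbhs u) (nbhs u) (nbhs t) _ _ _ id (fun=> t) cvg_id (cvg_cst t)).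
have hV : \forall v \near u, cylinder (v, t) -> modulus (H (v, t) - H (u, t)) < e.
  exact: ct _ hU.
by apply: filterS hV => v; apply; exact/cylinderP.
Qed.

(** The tube lemma: uniformity in [u] comes from compactness of the base. *)
Lemma uniform_time_step (H : X * R -> C) : compact [set: X] ->
  {within cylinder, continuous H} ->
  exists n : nat, forall u s t, 0 <= s <= 1 -> 0 <= t <= 1 ->
    `|t - s| < n.+1%:R^-1 -> modulus (H (u, t) - H (u, s)) < 1.
Proof.
move=> cX /subspace_continuousP cH.
have cK : compact cylinder by apply: compact_setX => //; exact: segment_compact.
have /compact_near_coveringP/near_covering_withinP nc := cK.
have key x : cylinder x -> \forall y \near x & n \near \oo, cylinder y ->
    forall t, 0 <= t <= 1 -> `|t - y.2| < n.+1%:R^-1 ->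
      modulus (H (y.1, t) - H y) < 1.
  case: x => u0 s0 Kx; have e2 : 0 < 1 / 2 :> R by rewrite divr_gt0.
  have /cvg_modulusP /(_ _ e2) := cH _ Kx.
  move=> [[/= U V] [nU /nbhs_ballP[d /= d0 dV]] UV].
  have d2 : 0 < d / 2 by rewrite divr_gt0.
  have nd : \forall n \near \oo, n.+1%:R^-1 < d / 2 :> R.
    near=> n; rewrite invf_plt ?posrE//.
    rewrite (@lt_trans _ _ n%:R) ?ltr_nat//.
    by near: n; exact: nbhs_infty_gtr.
  exists (U `*` ball s0 (d / 2), [set n | n.+1%:R^-1 < d / 2 :> R]).
    split=> //; exists (U, ball s0 (d / 2)) => //; split=> //.
    exact: nbhsx_ballx.
  move=> [[u s] n] /= [[Uu bs] hn] Ky t t01 ts.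
  have Vs : V s.
    by apply: dV; move: bs; rewrite /ball /= => /lt_le_trans; apply; lra.
  have Vt : V t.
    apply: dV; move: bs; rewrite /ball /= => bs.
    have -> : s0 - t = (s0 - s) - (t - s) by ring.
    rewrite (le_lt_trans (ler_normB _ _))// [ltRHS]splitr ltrD//.
    exact: lt_trans ts hn.
  have h1 := UV (u, s) (conj Uu Vs) Ky.
  have h2 := UV (u, t) (conj Uu Vt) (proj2 (cylinderP u t) t01).
  have -> : H (u, t) - H (u, s) = (H (u, t) - H (u0, s0)) - (H (u, s) - H (u0, s0)).
    by rewrite opprB addrA subrK.
  rewrite (le_lt_trans (modulusB _ _))//.
  move: h1 h2 => /=; move: (modulus _) (modulus _) => a b h1 h2; lra.
have [n _ hn] := nc _ _ (fun n y => forall t, 0 <= t <= 1 -> `|t - y.2| < n.+1%:R^-1 ->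
      modulus (H (y.1, t) - H y) < 1) (@eventually_filter) key.
exists n => u s t s01 t01; exact: (hn n (leqnn n) (u, s) (proj2 (cylinderP u s) s01)).
Unshelve. all: by end_near. Qed.

Lemma continuous_phaseB (th ph : X -> R) : continuous ph -> continuous th ->
  continuous (fun u => ph u - th u).
Proof. by move=> cph cth u; exact: cvgB (cph u) (cth u). Qed.

(** The quotient [g / f] stays in the right half plane, where [asin \o Im] is a
    continuous argument. *)
Lemma small_lift (f g : X -> C) : continuous f -> continuous g ->
  (forall u, modulus (f u) = 1) -> (forall u, modulus (g u) = 1) ->
  (forall u, modulus (g u - f u) < 1) ->
  exists th : X -> R, [/\ continuous th, forall u, `|th u| <= pi &
    forall u, g u = f u * cis (th u)].
Proof.
move=> cf cg f1 g1 fg.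
have f0 u : f u != 0 by rewrite -modulus_eq0 f1 oner_eq0.
pose r u := g u * (f u)^-1.
have cr : continuous r by exact: continuous_mul cg (continuous_inv f0 cf).
have r1 u : modulus (r u) = 1 by rewrite modulusM modulusV f1 g1 invr1 mulr1.
have rr u : modulus (1 - r u) < 1.
  have -> : 1 - r u = - ((g u - f u) * (f u)^-1) by rewrite mulrBl divff// opprB.
  by rewrite modulusN modulusM modulusV f1 invr1 mulr1.
have Re0 u : 0 < complex.Re (r u).
  have := Re_le_modulus (1 - r u); rewrite raddfB /= ler_norml => /andP[_ h].
  by have := rr u; lra.
have ReIm u : complex.Re (r u) ^+ 2 + complex.Im (r u) ^+ 2 = 1.
  have := r1 u; rewrite modulus_ReIm => h.
  have := sqr_sqrtr (addr_ge0 (sqr_ge0 (complex.Re (r u))) (sqr_ge0 (complex.Im (r u)))).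
  by rewrite h expr1n.
have Im1 u : -1 < complex.Im (r u) < 1.
  have := ReIm u; have : 0 < complex.Re (r u) ^+ 2 by rewrite exprn_gt0.
  by move=> h1 h2; apply/andP; split; nra.
have Im1' u : -1 <= complex.Im (r u) <= 1 by have /andP[/ltW -> /ltW ->] := Im1 u.
exists (fun u => asin (complex.Im (r u))); split.
- move=> u; apply: (@cvg_comp _ _ _ (fun u => complex.Im (r u)) (@asin R) _ (nbhs (complex.Im (r u)))).
    exact: cvg_Im (cr u).
  exact: continuous_asin (Im1 u).
- move=> u; have := asin_geNpi2 (Im1' u); have := asin_lepi2 (Im1' u).
  have := pi_ge0 R; rewrite ler_norml => *; apply/andP; split; lra.
- move=> u; have -> : cis (asin (complex.Im (r u))) = r u.
    rewrite /cis cos_asin// asinK; last by rewrite in_itv /=.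
    rewrite -(ReIm u) addrK sqrtr_sqr gtr0_norm//.
    by case: (r u).
  by rewrite /r mulrC divfK.
Qed.

(** Over a compact base, the endpoints of a homotopy of circle-valued maps
    differ by a bounded continuous phase: cut the homotopy into short steps. *)
Lemma homotopic_phase (f g : X -> C) : compact [set: X] ->
  homotopic_in R (@circle R) f g ->
  exists th B, [/\ continuous th, forall u, `|th u| <= B,
    forall u, modulus (f u) = 1 & forall u, g u = f u * cis (th u)].
Proof.
move=> cX [H [cH Hc H0 H1]]; have [n hn] := uniform_time_step cX cH.
(* steps of length [1 / (n + 2)], strictly below [1 / (n + 1)] *)
pose tm i : R := i%:R / n.+2%:R.
have tm01 i : (i <= n.+2)%N -> 0 <= tm i <= 1.
  move=> i_le; rewrite divr_ge0//= ler_pdivrMr// mul1r ler_nat//.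
have mH u t : 0 <= t <= 1 -> modulus (H (u, t)) = 1.
  by move=> t01; apply/circleP; exact: Hc.
have lift i : (i <= n.+2)%N -> exists th B, [/\ continuous th,
    forall u, `|th u| <= B & forall u, H (u, tm i) = H (u, 0) * cis (th u)].
  elim: i => [_|i IH i_lt].
    exists (fun=> 0), 0; split=> [u|u|u]; first exact: cvg_cst.
      by rewrite normr0.
    by rewrite /tm mul0r cis0 mulr1.
  have [th [B [cth thB thE]]] := IH (ltnW i_lt).
  have i0 := tm01 _ (ltnW i_lt); have i1 := tm01 _ i_lt.
  have [ph [cph phB phE]] : exists ph : X -> R, [/\ continuous ph,
      forall u, `|ph u| <= pi & forall u, H (u, tm i.+1) = H (u, tm i) * cis (ph u)].
    apply: small_lift => [||u|u|u]; [exact: homotopy_slice cH _|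
      exact: homotopy_slice cH _|exact: mH|exact: mH|].
    apply: hn => //; rewrite /tm -mulrBl -natrB// subSnn mul1r.
    by rewrite ger0_norm// ltf_pV2 ?posrE// ltr_nat.
  exists (fun u => th u + ph u), (B + pi); split.
  - by move=> u; apply: cvgD; [exact: cth|exact: cph].
  - by move=> u; rewrite (le_trans (ler_normD _ _))// lerD.
  - by move=> u; rewrite phE thE cisD mulrA.
have [th [B [cth thB thE]]] := lift _ (leqnn _).
exists th, B; split=> // u; first by rewrite -H0 mH// lexx ler01.
by rewrite -H1 -H0 -thE /tm divff// pnatr_eq0.
Qed.

End HomotopyLifting.

(** * Uniqueness of the winding number *)

Section WindingNumber.
Variable R : realType.
Local Notation C := (Cplx R).
Local Notation S := (solenoid R).

Lemma cis_eq1_small (w : R) : `|w| < pi -> cis w = 1 -> w = 0.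
Proof.
move=> w_pi /(congr1 (@complex.Im R)) /= sw.
have [w0|w0|//] := ltgtP w 0.
  have : 0 < sin (- w) by apply: sin_gt0_pi; move: w_pi; rewrite ltr0_norm//; lra.
  by rewrite sinN sw oppr0 ltxx.
have : 0 < sin w by apply: sin_gt0_pi; move: w_pi; rewrite gtr0_norm//; lra.
by rewrite sw ltxx.
Qed.

(** If [g] moved, it would take a value at distance [w] from [g 0] with
    [0 < |w| < 1 < pi]. *)
Lemma continuous_cis_eq1 (g : R -> R) t : continuous g ->
  (forall s, cis (g s) = 1) -> 0 <= t -> g t = g 0.
Proof.
move=> cg g1 t0; pose D := g t - g 0; pose w := D / (1 + `|D|).
have n0 : 0 < 1 + `|D| by rewrite ltr_pwDl.
have wpi : `|w| < pi.
  rewrite normrM normfV (gtr0_norm n0) ltr_pdivrMr//.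
  have := pi_ge2 R; have := normr_ge0 D; move: `|D| => x; nra.
have [c _ gc] : exists2 c, c \in `[0, t] & g c = g 0 + w.
  apply: IVT => //; first exact: continuous_subspaceT.
  have wD : w * (1 + `|D|) = D by rewrite divfK// gt_eqF.
  have {wD} : 0 <= w <= D \/ D <= w <= 0.
    by case: (ger0P D) wD n0 => hD wD n0; [left|right]; apply/andP; split; nra.
  by rewrite /D; case: (leP (g 0) (g t)) => h [] /andP[] *; apply/andP; split; lra.
have : cis w = 1.
  by have := g1 c; rewrite gc cisD g1 mul1r.
move=> /(cis_eq1_small wpi)/eqP; rewrite mulf_eq0 invr_eq0 (gt_eqF n0) orbF.
by rewrite subr_eq0 => /eqP.
Qed.

(** Along [line] the character [chi q] turns at constant speed [q], whereas a
    bounded phase cannot drift. *)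
Lemma chi_bounded_phase p q (th : S -> R) B : continuous th ->
  (forall u, `|th u| <= B) -> (forall u, chi q u = chi p u * cis (th u)) -> p = q.
Proof.
move=> cth thB E; pose d : R := ratr q - ratr p.
pose g t := d * t - th (line t).
have g1 t : cis (g t) = 1.
  rewrite /g cisD cisN mulrBl cisD cisN -!chi_line E.
  by rewrite mulrAC mulfK ?cis_neq0// divff// chi_neq0.
have cg : continuous g.
  move=> t; apply: cvgB; first by apply: cvgM; [exact: cvg_cst|exact: cvg_id].
  have cl := @continuous_line R.
  exact: (@continuous_comp R S R (@line R) th t (cl t) (cth (line t))).
have d0 : d = 0.
  apply: contrapT => /eqP d0; have B0 : 0 <= B by apply: le_trans (thB (line 0)).
  (* by this time the character has turned by more than the phase can vary *)
  pose t := (2 * B + 1) / `|d|.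
  have t0 : 0 <= t by rewrite divr_ge0// addr_ge0// mulr_ge0.
  have := continuous_cis_eq1 cg g1 t0; rewrite /g mulr0 sub0r => e.
  have {}e : d * t = th (line t) - th (line 0) by lra.
  have : `|d * t| <= B + B by rewrite e (le_trans (ler_normB _ _))// lerD.
  by rewrite normrM (ger0_norm t0) /t mulrC divfK ?normr_eq0//; lra.
by apply: (fmorph_inj (@ratr R)); apply/esym/eqP; rewrite -subr_eq0 -/d d0.
Qed.

Lemma winding_number_unique (f : S -> C) p q :
  homotopic_in R (@circle R) f (@chi R p) -> homotopic_in R (@circle R) f (@chi R q) ->
  p = q.
Proof.
move=> /(homotopic_phase (@compact_solenoid R))[th [B [cth thB f1 thE]]].
move=> /(homotopic_phase (@compact_solenoid R))[ph [D [cph phD _ phE]]].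
apply: (@chi_bounded_phase p q (fun u => ph u - th u) (D + B)).
- exact: continuous_phaseB.
- by move=> u; rewrite (le_trans (ler_normB _ _))// lerD.
- move=> u; rewrite phE thE cisD cisN -mulrA; congr (_ * _).
  by rewrite [RHS]mulrC divfK ?cis_neq0.
Qed.

End WindingNumber.

Theorem theorem4 (R : realType) (f : solenoid R -> Cplx R)
    (hf : units_of (@wiener R) f) :
  exists q : rat,
    is_winding_number f q /\
    (exists fm fp : solenoid R -> Cplx R, is_factorization f fm q fp) /\
    (forall (q' : rat) (fm fp : solenoid R -> Cplx R),
       is_factorization f fm q' fp -> q' = q).
Proof.
have [q [fm [fp [fact0 null0]]]] := factorizes_unit hf.
have [_ _ fE] := fact0.
exists q; split; last split; last 1 first.
- move=> q' fm' fp' fact1; apply/eqP; rewrite eq_le.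
  by rewrite (factorization_exponent_le fact0 fact1) (factorization_exponent_le fact1 fact0).
- have h : homotopic_in R (@circle R) (fun u => f u / `|f u| : Cplx R) (@chi R q).
    have := null_homotopic_homotopic (@continuous_chi R q) (@modulus_chi R q) null0.
    congr homotopic_in; apply/funext => u.
    by rewrite fE [fm u * _ * _]mulrAC.
  by split=> // p; exact: winding_number_unique h.
- by exists fm, fp.
Qed.
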